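(* Let $N\ge1$ be a natural number and $h=\frac1N$. Let $\mathring\ell$ be the error functional $$(\mathring\ell,\varphi)=\int_0^1\varphi(x)\,dx-\sum_{\beta=0}^N\bigl(C_0[\beta]\varphi(h\beta)+\mathring C_1[\beta]\varphi'(h\beta)\bigr),$$ where $C_0[0]=C_0[N]=\frac h2$, $C_0[\beta]=h$ for $1\le\beta\le N-1$, and $\mathring C_1[0]=\frac{h(e^h+1)}{2(e^h-1)}-1$, $\mathring C_1[\beta]=0$ for $1\le\beta\le N-1$, $\mathring C_1[N]=1-\frac{h(e^h+1)}{2(e^h-1)}$. Let $\ell_{EM}$ be the error functional of the Euler–Maclaurin quadrature formula, $$(\ell_{EM},\varphi)=\int_0^1\varphi(x)\,dx-\sum_{\beta=0}^NC_0[\beta]\varphi(h\beta)-\frac{h^2}{12}\bigl(\varphi'(0)-\varphi'(1)\bigr).$$ Then the error of the first formula on $W_2^{(2,1)}(0,1)$ is less than the error of the Euler–Maclaurin formula on $L_2^{(2)}(0,1)$, that is, $$\bigl\|\mathring\ell|W_2^{(2,1)*}(0,1)\bigr\|<\bigl\|\ell_{EM}|L_2^{(2)*}(0,1)\bigr\|.$$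
   Context: Both $W_2^{(2,1)}(0,1)$ and $L_2^{(2)}(0,1)$ consist of the real functions $\varphi$ on $[0,1]$ having an absolutely continuous first derivative and second derivative in $L_2(0,1)$, but they carry different semi-norms: $$\|\varphi|W_2^{(2,1)}(0,1)\|=\Bigl[\int_0^1(\varphi''(x)+\varphi'(x))^2dx\Bigr]^{1/2},\qquad \|\varphi|L_2^{(2)}(0,1)\|=\Bigl[\int_0^1(\varphi''(x))^2dx\Bigr]^{1/2}.$$ For $X$ either of these spaces and a linear functional $\ell$ vanishing on the functions of zero semi-norm (spanned by $1,e^{-x}$ for $W_2^{(2,1)}$, and by $1,x$ for $L_2^{(2)}$), the norm is $\|\ell|X^*\|=\sup_{\|\varphi|X\|=1}|(\ell,\varphi)|$. It is known that $\|\ell_{EM}|L_2^{(2)*}(0,1)\|^2=\frac{h^4}{720}$. *)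

(* Defs.v *)
From mathcomp Require Import all_boot all_order all_algebra.
From mathcomp Require Import all_classical all_reals all_analysis.
Set Implicit Arguments.
Unset Strict Implicit.
Unset Printing Implicit Defensive.
Import Order.TTheory GRing.Theory Num.Theory.
Import numFieldNormedType.Exports.
Local Open Scope classical_set_scope.
Local Open Scope ring_scope.

Section Defs.
Context {R : realType}.
Implicit Types (f phi : R -> R) (x : R) (N beta : nat).

Local Notation mu := (@lebesgue_measure R).

(* Functions on [0, 1] are represented by total functions R -> R.  Every
   definition below depends only on the restriction of its argument to [0, 1]:
   derivatives are taken relative to [0, 1], hence are one-sided at 0 and 1. *)
Definition dquot01 f x : set_system R :=
  (f y - f x) / (y - x) @[y --> within `[0, 1]%classic x^'].

Definition derivable01 f x : Prop := cvg (dquot01 f x).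

Definition deriv01 f x : R := lim (dquot01 f x).

Definition abs_continuous (a b : R) f : Prop :=
  forall e : R, 0 < e -> exists2 d : R, 0 < d &
    forall (n : nat) (u v : 'I_n -> R),
      (forall i, a <= u i /\ u i <= v i /\ v i <= b) ->
      trivIset setT (fun i => `]u i, v i[%classic) ->
      \sum_(i < n) (v i - u i) < d ->
      \sum_(i < n) `|f (v i) - f (u i)| < e.

(* The common underlying set of W_2^(2,1)(0,1) and L_2^(2)(0,1).  Since phi' is
   absolutely continuous, phi'' exists almost everywhere; lim takes a constant
   default value on the exceptional null set. *)
Definition sobolev2 : set (R -> R) := [set phi |
  [/\ forall x, 0 <= x <= 1 -> derivable01 phi x,
      abs_continuous 0 1 (deriv01 phi) &
      deriv01 (deriv01 phi) \_ `[0, 1] \in Lfun mu 2%:E]].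

Definition W21_norm phi : R :=
  Num.sqrt (\int[mu]_(x in `[0, 1])
              (deriv01 (deriv01 phi) x + deriv01 phi x) ^+ 2).

Definition L22_norm phi : R :=
  Num.sqrt (\int[mu]_(x in `[0, 1]) (deriv01 (deriv01 phi) x) ^+ 2).

(* ||l|X^*|| for the space X of the functions of sobolev2 with the semi-norm
   nrm, as an extended real. *)
Definition dual_norm (nrm : (R -> R) -> R) (l : (R -> R) -> R) : \bar R :=
  ereal_sup [set (`|l phi|)%:E | phi in [set phi | sobolev2 phi /\ nrm phi = 1]].

Definition step N : R := N%:R^-1.

Definition C0 N beta : R :=
  if (beta == 0)%N || (beta == N) then step N / 2 else step N.

Definition C1 N beta : R :=
  let h := step N in
  if (beta == 0)%N then h * (expR h + 1) / (2 * (expR h - 1)) - 1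
  else if beta == N then 1 - h * (expR h + 1) / (2 * (expR h - 1))
  else 0.

Definition ell_opt N phi : R :=
  \int[mu]_(x in `[0, 1]) phi x
  - \sum_(beta < N.+1) (C0 N beta * phi (step N * beta%:R)
                        + C1 N beta * deriv01 phi (step N * beta%:R)).

Definition ell_EM N phi : R :=
  \int[mu]_(x in `[0, 1]) phi x
  - \sum_(beta < N.+1) C0 N beta * phi (step N * beta%:R)
  - step N ^+ 2 / 12 * (deriv01 phi 0 - deriv01 phi 1).

End Defs.

(* Main.v *)
Require Import Defs.
From mathcomp Require Import all_boot all_order all_algebra.
From mathcomp Require Import all_classical all_reals all_analysis.
From mathcomp Require Import ring lra.
From mathcomp Require Import measurable_realfun.
From HB Require Import structures.
Set Implicit Arguments.
Unset Strict Implicit.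
Unset Printing Implicit Defensive.
Import Order.TTheory GRing.Theory Num.Theory.
Import numFieldNormedType.Exports.
Local Open Scope classical_set_scope.
Local Open Scope ring_scope.

(* On each mesh interval [a, b] with midpoint m, let kerEM solve K' = x - m and
   kerOpt solve K' = K + (x - m), each with equal values at a and b and mean zero.
   Integration by parts gives
     l_EM(phi) = sum_k int kerEM phi'',   l_opt(phi) = sum_k int kerOpt (phi'' + phi').
   The difference D of the kernels satisfies D' = kerOpt and is periodic, so
   ||kerEM||^2 = ||kerOpt||^2 + ||D||^2 > ||kerOpt||^2.  By Cauchy-Schwarz the norm
   of l_opt is at most ||kerOpt||, and phi'' = kerEM / ||kerEM|| shows that the
   norm of l_EM is at least ||kerEM||.

   Since phi' is only absolutely continuous, the integration by parts needs the
   Lebesgue form of the fundamental theorem of calculus.  An absolutely continuous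
   function is a difference of nondecreasing ones through its total variation; the
   Lebesgue-Stieltjes measure of each is dominated by the Lebesgue measure, and its
   Radon-Nikodym density is the a.e. derivative by Lebesgue differentiation. *)

(** * Absolutely continuous functions *)

Section AbsContinuous.
Context {R : realType}.
Implicit Types (f g : R -> R) (a b e : R).

(** Arbitrary finite index types are needed because the pieces of several subdivisions, indexed by
    dependent pairs, will be treated as one family. *)
Lemma abs_continuous_fin a b f : abs_continuous a b f ->
  forall e : R, 0 < e -> exists2 d : R, 0 < d &
    forall (T : finType) (u v : T -> R),
      (forall i, a <= u i /\ u i <= v i /\ v i <= b) ->
      trivIset setT (fun i => `]u i, v i[%classic) ->
      \sum_i (v i - u i) < d ->
      \sum_i `|f (v i) - f (u i)| < e.
Proof.
move=> acf e e0; have [d d0 h] := acf e e0; exists d => // T u v uv tuv sd.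
have := h #|T| (u \o enum_val) (v \o enum_val).
rewrite /= -(big_enum_val (fun i => v i - u i)).
rewrite -(big_enum_val (fun i => `|f (v i) - f (u i)|)).
apply => //.
move=> i j _ _ ij; apply: enum_val_inj; exact: tuv.
Qed.

Lemma abs_continuousW a b a' b' f : a <= a' -> b' <= b ->
  abs_continuous a b f -> abs_continuous a' b' f.
Proof.
move=> aa bb acf e e0; have [d d0 h] := acf e e0; exists d => // n u v uv.
apply: h => i; have [? [? ?]] := uv i; split; first exact: le_trans aa _.
by split => //; exact: le_trans bb.
Qed.

Lemma abs_continuous_dist a b f : abs_continuous a b f ->
  forall e : R, 0 < e -> exists2 d : R, 0 < d &
    forall x y, a <= x -> x <= y -> y <= b -> y - x < d -> `|f y - f x| < e.
Proof.
move=> acf e e0; have [d d0 h] := acf e e0; exists d => // x y ax xy yb xyd.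
have := h 1%N (fun=> x) (fun=> y); rewrite !big_ord1; apply => //.
by move=> i j _ _ _; rewrite !ord1.
Qed.

Lemma eq_abs_continuous a b f g : (forall x, a <= x <= b -> f x = g x) ->
  abs_continuous a b f -> abs_continuous a b g.
Proof.
move=> fg acf e e0; have [d d0 h] := acf e e0; exists d => // n u v uv tuv sd.
have -> : \sum_(i < n) `|g (v i) - g (u i)| = \sum_(i < n) `|f (v i) - f (u i)|.
  apply: eq_bigr => i _; have [? [? ?]] := uv i.
  by rewrite !fg//; apply/andP; split => //; apply: le_trans; eassumption.
exact: h.
Qed.

Lemma abs_continuousB a b f g :
  abs_continuous a b f -> abs_continuous a b g -> abs_continuous a b (f \- g).
Proof.
move=> acf acg e e0.
have [d1 d10 h1] := acf (e / 2) (divr_gt0 e0 (ltr0Sn _ _)).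
have [d2 d20 h2] := acg (e / 2) (divr_gt0 e0 (ltr0Sn _ _)).
exists (Num.min d1 d2); first by rewrite lt_min d10.
move=> n u v uv tuv; rewrite lt_min => /andP[sd1 sd2].
rewrite [e]splitr; apply: le_lt_trans (ltrD (h1 _ _ _ uv tuv sd1) (h2 _ _ _ uv tuv sd2)).
rewrite -big_split; apply: ler_sum => i _ /=.
rewrite (_ : f (v i) - _ - _ = (f (v i) - f (u i)) - (g (v i) - g (u i))); last by ring.
exact: ler_normB.
Qed.

Lemma abs_continuousM a b f g M :
  (forall x, a <= x <= b -> `|f x| <= M) -> (forall x, a <= x <= b -> `|g x| <= M) ->
  abs_continuous a b f -> abs_continuous a b g -> abs_continuous a b (f \* g).
Proof.
move=> fM gM acf acg e e0.
(* The bound [M] may be zero; [C] dominates it and can be divided by. *)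
pose C := `|M| + 1; have C0 : 0 < C by rewrite ltr_wpDl.
have eC : 0 < e / C / 2 by rewrite !divr_gt0.
have [d1 d10 h1] := acf _ eC.
have [d2 d20 h2] := acg _ eC.
exists (Num.min d1 d2); first by rewrite lt_min d10.
move=> n u v uv tuv; rewrite lt_min => /andP[sd1 sd2].
rewrite (_ : e = C * (e / C / 2) + C * (e / C / 2)); last first.
  by field; rewrite gt_eqF.
have MC : M <= C by rewrite /C (le_trans (ler_norm M))// lerDl.
apply: (@le_lt_trans _ _ (C * (\sum_(i < n) `|f (v i) - f (u i)|) +
                          C * (\sum_(i < n) `|g (v i) - g (u i)|))); last first.
  by rewrite ltrD// ltr_pM2l//; [exact: h1|exact: h2].
rewrite !mulr_sumr -big_split; apply: ler_sum => i _ /=.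
have [ua [ui ub]] := uv i.
have vI : a <= v i <= b by rewrite (le_trans ua).
have uI : a <= u i <= b by rewrite ua (le_trans ui).
rewrite (_ : f (v i) * _ - _ = g (v i) * (f (v i) - f (u i)) + f (u i) * (g (v i) - g (u i))); last by ring.
apply: (le_trans (ler_normD _ _)); rewrite !normrM.
by apply: lerD; apply: ler_wpM2r => //; apply: (le_trans _ MC); auto.
Qed.

Lemma lipschitz_abs_continuous a b f M :
  (forall x y, a <= x -> x <= y -> y <= b -> `|f y - f x| <= M * (y - x)) ->
  abs_continuous a b f.
Proof.
move=> fM e e0; pose C := `|M| + 1; have C0 : 0 < C by rewrite ltr_wpDl.
exists (e / C); first exact: divr_gt0.
move=> n u v uv tuv; rewrite ltr_pdivlMr// => sd.
apply: le_lt_trans sd; rewrite mulr_suml; apply: ler_sum => i _.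
have [ua [ui ub]] := uv i.
apply: (le_trans (fM _ _ ua ui ub)); rewrite mulrC ler_wpM2l ?subr_ge0//.
by rewrite /C (le_trans (ler_norm M))// lerDl.
Qed.

(** Subdividing disjoint intervals produces a finer disjoint family of the same total length, so the
    [d] given by absolute continuity also controls the variations along the subdivisions. *)
Lemma variation_sum_lt a b f : abs_continuous a b f ->
  forall e : R, 0 < e -> exists2 d : R, 0 < d &
    forall n (u v : 'I_n -> R) (s : 'I_n -> seq R),
      (forall i, a <= u i /\ u i <= v i /\ v i <= b) ->
      trivIset setT (fun i => `]u i, v i[%classic) ->
      \sum_i (v i - u i) < d ->
      (forall i, itv_partition (u i) (v i) (s i)) ->
      \sum_i variation (u i) (v i) f (s i) < e.
Proof.
move=> acf e e0; have [d d0 h] := abs_continuous_fin acf e0.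
exists d => // n u v s uv tuv sd us.
(* [F i] lists the subdivision points starting from [u i]; the default [v i] keeps it nondecreasing
   past the last index. *)
pose F i := nth (v i) (u i :: s i).
pose T := {i : 'I_n & 'I_(size (s i))} : finType.
have -> : \sum_i variation (u i) (v i) f (s i) =
    \sum_(p : T) `|f (F (tag p) (tagged p).+1) - f (F (tag p) (tagged p))|.
  rewrite -(@sig_big_dep _ _ _ _ (fun i => 'I_(size (s i))) predT (fun _ _ => true)
     (fun i (j : 'I_(size (s i))) => `|f (F i j.+1) - f (F i j)|)).
  by apply: eq_bigr => i _; rewrite /variation big_mkord.
have Fm i k l : (k <= l)%N -> F i k <= F i l.
  move=> kl; rewrite /F.
  have ndF : {homo F i : k l / (k <= l)%N >-> k <= l}.
    apply: (homo_leq (@lexx _ _) (@le_trans _ _)) => k'.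
    have [ks|ks] := ltnP k' (size (s i)).
      by apply: (nondecreasing_fun_itv_partition (f := id)) ks.
    rewrite /F /= [leRHS]nth_default//.
    move: ks; rewrite leq_eqVlt => /predU1P[<-|ks]; last by rewrite nth_default.
    by rewrite itv_partition_nth_le.
  exact: ndF.
have Fl i k : (k <= size (s i))%N -> u i <= F i k <= v i.
  by move=> ks; rewrite itv_partition_nth_ge//= itv_partition_nth_le.
apply: (h T (fun p => F (tag p) (tagged p)) (fun p => F (tag p) (tagged p).+1)).
- move=> [i j] /=; have [ua [ui ub]] := uv i.
  have /andP[? _] := Fl i j (ltnW (ltn_ord j)).
  have /andP[_ ?] := Fl i j.+1 (ltn_ord j).
  split; first exact: le_trans ua _.
  by split; [exact: Fm|exact: le_trans ub].
(* A point common to two pieces lies in both enclosing intervals, so these coincide; monotonicity of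
   [F i] then forces equal positions in the subdivision. *)
- move=> [i j] [i' j'] _ _ /= [x [/=]]; rewrite !in_itv/= => /andP[x1 x2] /andP[x3 x4].
  have ii' : i = i'.
    apply: tuv => //; exists x; split => /=; rewrite in_itv/=.
      have /andP[? _] := Fl i j (ltnW (ltn_ord j)).
      have /andP[_ ?] := Fl i j.+1 (ltn_ord j).
      by apply/andP; split; [exact: le_lt_trans x1|exact: lt_le_trans x2 _].
    have /andP[? _] := Fl i' j' (ltnW (ltn_ord j')).
    have /andP[_ ?] := Fl i' j'.+1 (ltn_ord j').
    by apply/andP; split; [exact: le_lt_trans x3|exact: lt_le_trans x4 _].
  subst i'; congr existT; apply/val_inj => /=.
  have [jj|jj|//] := ltngtP j j'.
    by have := lt_trans x3 x2; rewrite ltNge Fm.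
  by have := lt_trans x1 x4; rewrite ltNge Fm.
- rewrite -(@sig_big_dep _ _ _ _ (fun i => 'I_(size (s i))) predT (fun _ _ => true)
     (fun i (j : 'I_(size (s i))) => F i j.+1 - F i j)).
  rewrite (eq_bigr (fun i => v i - u i))// => i _ /=.
  rewrite -(big_mkord predT (fun j => F i j.+1 - F i j)) telescope_sumr//.
  by rewrite /F (itv_partition_nth_size _ (us i)).
Qed.

(** Choose subdivisions that nearly attain each total variation and apply the previous bound to all
    of them at once; the supremum costs the strictness of the inequality. *)
Lemma total_variation_sum_le a b f : abs_continuous a b f ->
  forall e : R, 0 < e -> exists2 d : R, 0 < d &
    forall n (u v : 'I_n -> R),
      (forall i, a <= u i /\ u i <= v i /\ v i <= b) ->
      trivIset setT (fun i => `]u i, v i[%classic) ->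
      \sum_i (v i - u i) < d ->
      (\sum_i total_variation (u i) (v i) f <= e%:E)%E.
Proof.
move=> acf e e0; have [d d0 h] := variation_sum_lt acf e0.
exists d => // n u v uv tuv sd.
have uvd i : v i - u i < d.
  apply: le_lt_trans sd; rewrite (bigD1 i)//= lerDl sumr_ge0// => j _.
  by have [_ [? _]] := uv j; rewrite subr_ge0.
(* Each interval alone is shorter than [d], so the one-interval case bounds all its variations by
   [e]. *)
have TVfin i : total_variation (u i) (v i) f \is a fin_num.
  have [ua [ui ub]] := uv i.
  apply/bounded_variationP => //; exists e => _ [s us <-]; apply/ltW.
  have := h 1%N (fun=> u i) (fun=> v i) (fun=> s); rewrite !big_ord1; apply => //.
  by move=> k l _ _ _; rewrite !ord1.
apply/lee_addgt0Pr => t t0.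
(* The slack [t] is shared among the [n] intervals; [n.+1] keeps the divisor nonzero when [n] is
   zero. *)
have tn : 0 < t / n.+1%:R by rewrite divr_gt0.
have /choice[s hs] : forall i, exists s, itv_partition (u i) (v i) s /\
    (total_variation (u i) (v i) f <= (variation (u i) (v i) f s + t / n.+1%:R)%:E)%E.
  move=> i; have [_ [x [s us <-] <-] lt] := ub_ereal_sup_adherent tn (TVfin i).
  exists s; split => //; move: lt; rewrite -/(total_variation _ _ _).
  by rewrite lteBlDr// => /ltW; rewrite -EFinD.
apply: (@le_trans _ _ (\sum_i (variation (u i) (v i) f (s i) + t / n.+1%:R)%:E)%E).
  by apply: lee_sum => i _; have [] := hs i.
rewrite sumEFin lee_fin big_split/= lerD//.
  by apply: ltW; apply: h => // i; have [] := hs i.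
rewrite sumr_const card_ord -[leLHS]mulr_natl mulrCA ler_piMr ?(ltW t0)//.
by rewrite ler_pdivrMr// mul1r ler_nat.
Qed.

(** Cut [[a, b]] into finitely many pieces shorter than the [d] attached to [1]: each piece
    contributes at most [1] to the total variation. *)
Lemma abs_continuous_bounded_variation a b f : a <= b ->
  abs_continuous a b f -> bounded_variation a b f.
Proof.
move=> ab acf; have [d d0 h] := total_variation_sum_le acf ltr01.
have TV1 x y : a <= x -> x <= y -> y <= b -> y - x < d ->
    (total_variation x y f <= 1)%E.
  move=> ax xy yb xyd; have := h 1%N (fun=> x) (fun=> y); rewrite !big_ord1.
  by apply => //; move=> k l _ _ _; rewrite !ord1.
(* One more than the integer part of [(b - a) / d] makes the length [(b - a) / m] smaller than
   [d]. *)
pose m := (Num.trunc ((b - a) / d)).+1.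
pose t (k : nat) := a + (b - a) * (k%:R / m%:R).
have tm : t m = b by rewrite /t divff ?pnatr_eq0// mulr1 addrC subrK.
have t0 : t 0%N = a by rewrite /t mul0r mulr0 addr0.
have tS k : t k <= t k.+1.
  by rewrite /t lerD2l ler_wpM2l ?subr_ge0// ler_wpM2r// ler_nat.
have tle : {homo t : k l / (k <= l)%N >-> k <= l}.
  exact: (homo_leq (@lexx _ _) (@le_trans _ _)).
have td k : t k.+1 - t k < d.
  rewrite /t -natr1 (_ : _ - _ = (b - a) / m%:R); last by ring.
  by rewrite ltr_pdivrMr// mulrC -ltr_pdivrMr// truncnS_gt.
(* The alternative [b < t k] lets the induction run over all [k], including those beyond [m]. *)
have TVt k : (total_variation a (t k) f <= k%:R%:E)%E \/ b < t k.
  elim: k => [|k [ih|]]; first by left; rewrite t0 total_variationxx.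
    have [tb|] := leP (t k.+1) b; last by right.
    left; have at_ : a <= t k by rewrite -t0; exact: tle.
    rewrite (total_variationD f at_ (tS k)) -natr1 EFinD leeD// TV1//.
  by move=> bt; right; exact: lt_le_trans bt _.
apply/bounded_variationP => //; rewrite ge0_fin_numE; last exact: total_variation_ge0.
by have := TVt m; rewrite tm ltxx => -[/le_lt_trans->//|//]; rewrite ltry.
Qed.

Lemma total_variation_fin a b f x y : abs_continuous a b f ->
  a <= x -> x <= y -> y <= b -> total_variation x y f \is a fin_num.
Proof.
move=> acf ax xy yb; apply/bounded_variationP => //.
by apply: abs_continuous_bounded_variation => //; exact: abs_continuousW acf.
Qed.

Lemma fine_total_variationB a b f x y : abs_continuous a b f ->
  a <= x -> x <= y -> y <= b ->
  (fine (total_variation a y f) - fine (total_variation a x f))%:E =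
  total_variation x y f.
Proof.
move=> acf ax xy yb; rewrite (total_variationD f ax xy).
have fx := total_variation_fin acf (lexx a) ax (le_trans xy yb).
have fxy := total_variation_fin acf ax xy yb.
by rewrite fineD// addrAC subrr add0r fineK.
Qed.

(** An increment of the variation function over [[u, v]] is the total variation of [f] there, so
    [total_variation_sum_le] applies directly; [e / 2] restores the strict inequality. *)
Lemma abs_continuous_total_variation a b f : abs_continuous a b f ->
  abs_continuous a b (fine \o total_variation a ^~ f).
Proof.
move=> acf e e0.
have [d d0 h] := total_variation_sum_le acf (divr_gt0 e0 (ltr0Sn _ 1)).
exists d => // n u v uv tuv sd.
apply: (@le_lt_trans _ _ (e / 2)); last by rewrite ltr_pdivrMr// ltr_pMr// ltr1n.
rewrite -lee_fin; apply: le_trans (h n u v uv tuv sd).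
rewrite -sumEFin; apply: lee_sum => i _; have [ua [ui ub]] := uv i.
rewrite -(fine_total_variationB acf ua ui ub) lee_fin /= ger0_norm// -lee_fin.
by rewrite (fine_total_variationB acf)// total_variation_ge0.
Qed.

(** Jordan decomposition with [g1 = V] and [g2 = V - f]: the latter is nondecreasing because an
    increment of [f] never exceeds the variation over the same interval. *)
Lemma abs_continuous_nondecreasingB a b f : abs_continuous a b f ->
  exists g1 g2 : R -> R, [/\ abs_continuous a b g1, abs_continuous a b g2,
    {in `[a, b] &, nondecreasing_fun g1}, {in `[a, b] &, nondecreasing_fun g2} &
    f = g1 \- g2].
Proof.
move=> acf; pose V := fine \o total_variation a ^~ f.
have acV : abs_continuous a b V := abs_continuous_total_variation acf.
exists V, (V \- f); split => //.
- exact: abs_continuousB.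
- move=> x y; rewrite !in_itv/= => /andP[ax xb] /andP[ay yb] xy.
  rewrite -subr_ge0 -lee_fin (fine_total_variationB acf)//.
  exact: total_variation_ge0.
- move=> x y; rewrite !in_itv/= => /andP[ax xb] /andP[ay yb] xy.
  rewrite -subr_ge0 [leRHS](_ : _ = (V y - V x) - (f y - f x)); last first.
    by rewrite /=; ring.
  rewrite subr_ge0 -lee_fin /V /= (fine_total_variationB acf)//.
  apply: le_trans (total_variation_ge f xy).
  by rewrite lee_fin ler_norm.
- by apply/funext => x /=; ring.
Qed.

End AbsContinuous.

(** * Stieltjes measures of absolutely continuous monotone functions *)

Lemma open_bounded_itv {R : realType} (a b : R) (I : set R) : a <= b ->
  open I -> is_interval I -> I `<=` `]a, b[ ->
  exists u v, [/\ a <= u, u <= v, v <= b & I = `]u, v[%classic].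
Proof.
move=> ab oI iI Iab; have [->|/set0P I0] := eqVneq I set0.
  by exists a, a; split => //; rewrite set_itvoo0.
have lI : has_lbound I.
  by exists a => x /Iab /=; rewrite in_itv/= => /andP[/ltW].
have uI : has_ubound I.
  by exists b => x /Iab /=; rewrite in_itv/= => /andP[_ /ltW].
have lt_inf x : I x -> inf I < x.
  (* Openness provides a point of [I] to the left of [x], so the infimum is not attained; the
     supremum is handled symmetrically. *)
  move=> Ix; have /nbhs_ballP[e /= e0 he] := open_nbhs_nbhs (conj oI Ix).
  apply: (@le_lt_trans _ _ (x - e / 2)); last by rewrite gtrBl divr_gt0.
  apply: ge_inf => //; apply: he; rewrite /ball/= opprB addrCA subrr addr0.
  by rewrite gtr0_norm ?divr_gt0// ltr_pdivrMr// ltr_pMr// ltr1n.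
have lt_sup x : I x -> x < sup I.
  move=> Ix; have /nbhs_ballP[e /= e0 he] := open_nbhs_nbhs (conj oI Ix).
  apply: (@lt_le_trans _ _ (x + e / 2)); first by rewrite ltrDl divr_gt0.
  apply: ub_le_sup => //; apply: he; rewrite /ball/= opprD addrA subrr sub0r.
  by rewrite normrN gtr0_norm ?divr_gt0// ltr_pdivrMr// ltr_pMr// ltr1n.
have [x0 Ix0] := I0.
exists (inf I), (sup I); split.
- by apply: lb_le_inf => // x /Iab /=; rewrite in_itv/= => /andP[/ltW].
- by rewrite (le_trans (ltW (lt_inf _ Ix0)))// ltW// lt_sup.
- by apply: ge_sup => // x /Iab /=; rewrite in_itv/= => /andP[_ /ltW].
- apply/seteqP; split => x /=; rewrite in_itv/=.
    by move=> Ix; rewrite lt_inf ?lt_sup.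
  move=> /andP[/(inf_lt I0)[y Iy yx] /(sup_gt I0)[z Iz xz]].
  by apply: (iI y z) => //; rewrite !ltW.
Qed.

Section AbsContinuousDensity.
Context {R : realType}.
Implicit Types (f g : R -> R) (a b e x y : R).
Local Notation mu := (@lebesgue_measure R).

(** Composition with [clip a b] extends a function from [[a, b]] to the whole line by constants. A
    monotone continuous function thus gets a Stieltjes measure carried by []a, b]]. *)
Definition clip a b x : R := Num.max a (Num.min x b).

Lemma clip_in a b x : a <= b -> a <= clip a b x <= b.
Proof. by move=> ab; rewrite /clip le_max lexx/= ge_max ab ge_min lexx orbT. Qed.

Lemma clip_id a b x : a <= x <= b -> clip a b x = x.
Proof. by move=> /andP[ax xb]; rewrite /clip min_l// max_r. Qed.

Lemma clip_le a b x y : x <= y -> clip a b x <= clip a b y.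
Proof.
by move=> xy; rewrite /clip ge_max !le_max lexx/= le_min !ge_min xy lexx !orbT.
Qed.

Lemma clip_itv a b x y z : clip a b x < z < clip a b y -> x < z < y.
Proof.
rewrite /clip gt_max lt_max => /andP[/andP[az]].
rewrite gt_min => /orP[xz|bz]; move/orP => -[za|].
- by have := lt_trans az za; rewrite ltxx.
- by rewrite lt_min xz => /andP[-> _].
- by have := lt_trans az za; rewrite ltxx.
- by rewrite lt_min => /andP[_ zb]; have := lt_trans bz zb; rewrite ltxx.
Qed.

Lemma clip_dist a b x y : x <= y -> clip a b y - clip a b x <= y - x.
Proof.
move=> xy; rewrite lerBlDr /clip ge_max; apply/andP; split.
  by rewrite addrC -lerBlDr (@le_trans _ _ a)// ?gerBl ?subr_ge0// le_max lexx.
have : Num.min x b <= Num.max a (Num.min x b) by rewrite le_max lexx orbT.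
move=> h; apply: le_trans (lerD (lexx (y - x)) h).
by rewrite /Num.min; case: ifPn => hx; case: ifPn => hy; lra.
Qed.

(** Clipping the end points turns each interval into a subinterval of itself, possibly empty, so
    disjointness and the smallness of the total length survive. *)
Lemma abs_continuous_clip a b c d g : a <= b ->
  abs_continuous a b g -> abs_continuous c d (g \o clip a b).
Proof.
move=> ab acg e e0; have [t t0 h] := acg e e0; exists t => // n u v uv tuv sd.
apply: (h n (clip a b \o u) (clip a b \o v)).
- move=> i; have [_ [ui _]] := uv i.
  have /andP[-> _] := clip_in (u i) ab; have /andP[_ ->] := clip_in (v i) ab.
  by rewrite clip_le.
- move=> i j _ _ [z [/= zi zj]]; apply: tuv => //; exists z.
  by split => /=; rewrite in_itv/=; [exact: clip_itv zi|exact: clip_itv zj].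
- apply: le_lt_trans sd; apply: ler_sum => i _ /=.
  by have [_ [ui _]] := uv i; exact: clip_dist.
Qed.

Lemma abs_continuous_continuous_clip a b g : a <= b ->
  abs_continuous a b g -> continuous (g \o clip a b).
Proof.
move=> ab acg x; apply/cvgrPdist_lt => e e0.
have [d d0 h] := abs_continuous_dist (abs_continuous_clip (x - 1) (x + 1) ab acg) e0.
have d10 : 0 < Num.min d 1 by rewrite lt_min d0 ltr01.
near=> y; have : `|x - y| < Num.min d 1.
  by near: y; exact: (@cvgr_dist_lt _ _ _ _ _ idfun).
rewrite lt_min => /andP[xyd xy1].
have [xy|/ltW yx] := leP x y; [rewrite distrC|]; apply: h => //.
- by rewrite gerBl.
- by move: xy1; rewrite ltr_norml => /andP[]; lra.
- by move: xyd; rewrite ltr_norml => /andP[]; lra.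
- by move: xy1; rewrite ltr_norml => /andP[]; lra.
- by rewrite lerDl.
- by move: xyd; rewrite ltr_norml => /andP[]; lra.
Unshelve. all: by end_near. Qed.

Lemma lebesgue_stieltjes_ocitv (G : cumulative R R) x y : x <= y ->
  lebesgue_stieltjes_measure G `]x, y] = (G y - G x)%:E.
Proof.
move=> xy; rewrite /lebesgue_stieltjes_measure /measure_extension.
by rewrite measurable_mu_extE/= ?wlength_itv_bnd//; exact: is_ocitv.
Qed.

(** The line is the increasing union of the intervals []-n, n]], whose mass is constant once [n]
    exceeds both absolute values of the end points. *)
Lemma lebesgue_stieltjes_clip_setT (G : cumulative R R) a b : a <= b ->
  (forall x, G x = G (clip a b x)) ->
  lebesgue_stieltjes_measure G setT = (G b - G a)%:E.
Proof.
move=> ab Gc; rewrite -(bigcup_itvT false false).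
pose I n : set R := `]- (n%:R), n%:R]%classic.
have : (lebesgue_stieltjes_measure G \o I) n @[n --> \oo] --> (G b - G a)%:E.
  apply: cvg_near_cst; near=> n => /=.
  have na : `|a| <= n%:R by near: n; exact: nbhs_infty_ger.
  have nb : `|b| <= n%:R by near: n; exact: nbhs_infty_ger.
  rewrite lebesgue_stieltjes_ocitv; last by rewrite (@le_trans _ _ 0)// oppr_le0.
  have bn : b <= n%:R := le_trans (ler_norm b) nb.
  have an : - n%:R <= a by move: na; rewrite ler_norml => /andP[].
  have an' : Num.min (- n%:R) b <= a by rewrite ge_min an.
  rewrite (Gc n%:R) (Gc (- n%:R)) /clip.
  by rewrite (min_r bn) (max_r ab) (max_l an').
have : (lebesgue_stieltjes_measure G \o I) n @[n --> \oo] -->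
    lebesgue_stieltjes_measure G (\bigcup_n I n).
  apply: nondecreasing_cvg_mu; rewrite /I//; first exact: bigcup_measurable.
  by move=> *; apply/subsetPset/subset_itv; rewrite leBSide/= ?lerN2 ler_nat.
exact: cvg_unique.
Unshelve. all: by end_near. Qed.

(* The margin beyond b makes every point of ]a, b] interior to ]a, b + 1[, so that
   an open cover can be intersected with the latter. *)
Lemma lebesgue_stieltjes_dominates (G : cumulative R R) a b : a <= b ->
  (forall x, G x = G (clip a b x)) -> abs_continuous a (b + 1) G ->
  lebesgue_stieltjes_measure G `<< mu.
Proof.
move=> ab Gc acG; set nu := lebesgue_stieltjes_measure G.
have ab1 : a <= b + 1 by rewrite (le_trans ab)// lerDl.
apply/null_content_dominatesP => A mA A0.
(* The total mass [G b - G a] is already that of []a, b]]. *)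
have nuC : nu (~` `]a, b]) = 0%E.
  have nuT := lebesgue_stieltjes_clip_setT ab Gc.
  have -> : nu (~` `]a, b]) = (nu setT - nu `]a, b]%classic)%E.
    have := @measureD _ _ _ (lebesgue_stieltjes_measure G) setT `]a, b]%classic
      measurableT (measurable_itv _).
    rewrite setTD setTI; apply.
    exact: (eq_ind_r (fun z => z < +oo)%E (ltry _) nuT).
  rewrite [nu setT]nuT [nu _](lebesgue_stieltjes_ocitv G ab).
  by rewrite subee.
apply/eqP; rewrite eq_le measure_ge0 andbT; apply/lee_addgt0Pr => e e0.
rewrite add0e.
have [d d0 h] := acG e e0.
have [U [oU AU Ud]] := lebesgue_regularity_outer mA
  (eq_ind_r (fun z => z < +oo)%E (ltry 0) A0) d0.
pose V := U `&` `]a, b + 1[.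
have oV : open V by apply: openI => //; exact: interval_open.
have Vd : (mu V < d%:E)%E.
  have A0' : mu A = 0%E := A0.
  have mUA : measurable (U `\` A) by apply: measurableD => //; exact: open_measurable.
  apply: le_lt_trans Ud; rewrite -[leRHS]adde0 -A0'.
  apply: (@le_trans _ _ (mu ((U `\` A) `|` A))); last exact: measureU2.
  apply: le_measure; rewrite ?inE.
  - exact: open_measurable.
  - exact: measurableU.
  - by move=> x [Ux _]; have [Ax|nAx] := pselect (A x); [right|left].
(* [A] is covered by the open set [V], of Lebesgue measure below [d], together with the complement
   of []a, b]], which is [nu]-null. *)
apply: (@le_trans _ _ (nu (V `|` ~` `]a, b]))).
  apply: le_measure; rewrite ?inE//.
    by apply: measurableU; [exact: open_measurable|exact: measurableC].
  move=> x Ax; have [xab|nx] := pselect (`]a, b]%classic x); last by right.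
  left; split; first exact: AU.
  move: xab; rewrite /= !in_itv/= => /andP[-> xb]/=.
  by rewrite (le_lt_trans xb)// ltrDl.
have nuU : (nu (V `|` ~` `]a, b]%classic) <= nu V)%E.
  rewrite -[leRHS]adde0 -[X in (_ + X)%E]nuC.
  apply: (measureU2 (lebesgue_stieltjes_measure G)); first exact: open_measurable.
  exact: measurableC.
apply: (le_trans nuU); rewrite (open_disjoint_itv_bigcup oV).
pose I := open_disjoint_itv oV.
have tI : trivIset setT I := @open_disjoint_itv_trivIset _ _ oV.
have oI i : open (I i) := @open_disjoint_itv_open _ _ oV i.
have mI i : measurable (I i) by exact: open_measurable.
have mUI : measurable (\bigcup_i I i).
  by rewrite -(open_disjoint_itv_bigcup oV); exact: open_measurable.
have /choice[u /choice[v Iuv]] : forall i, exists u, exists v,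
    [/\ a <= u, u <= v, v <= b + 1 & I i = `]u, v[%classic].
  move=> i; apply: open_bounded_itv => //.
    exact: open_disjoint_itv_is_interval.
  apply: (@subset_trans _ V); last by move=> x [].
  by rewrite [X in _ `<=` X](open_disjoint_itv_bigcup oV); exact: bigcup_sup.
(* The mass of [V] is the limit of sums over finitely many components. Their total length is at most
   that of [V], hence below [d], and absolute continuity bounds every such sum by [e]. *)
apply: (@lee_cvg_to _ \oo _ _ (fun n => \sum_(0 <= i < n) nu (I i))%E (fun=> e%:E)).
- exact: (@measure_semi_sigma_additive _ _ _ nu).
- exact: cvg_cst.
near=> n.
have tIn : trivIset setT (fun i : 'I_n => `]u i, v i[%classic).
  move=> i j _ _; have [_ _ _ <-] := Iuv i; have [_ _ _ <-] := Iuv j.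
  by move=> /(tI _ _ Logic.I Logic.I)/val_inj.
have uvn (i : 'I_n) : a <= u i /\ u i <= v i /\ v i <= b + 1.
  by have [? ? ? _] := Iuv i.
have he sd := ltW (h n _ _ uvn tIn sd).
apply: (@le_trans _ _ (\sum_(i < n) `|G (v i) - G (u i)|)%:E); last rewrite lee_fin he//.
  rewrite big_mkord -sumEFin; apply: lee_sum => i _.
  have [ui uvi vi ->] := Iuv i.
  rewrite (@le_trans _ _ (G (v i) - G (u i))%:E)//; last by rewrite lee_fin ler_norm.
  rewrite -lebesgue_stieltjes_ocitv//; apply: le_measure; rewrite ?inE//.
  by apply: subset_itvl; rewrite bnd_simp.
rewrite -lte_fin; apply: le_lt_trans Vd.
rewrite (open_disjoint_itv_bigcup oV) measure_semi_bigcup//.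
apply: (le_trans _ (nneseries_lim_ge n _)) => //.
rewrite big_mkord -sumEFin; apply: lee_sum => i _.
have [ui uvi vi Ii] := Iuv i; rewrite -/I Ii.
have -> : (v i - u i)%:E = mu `]u i, v i[%classic.
  rewrite lebesgue_measure_itv/= lte_fin.
  by case: ltP => // /(conj uvi)/andP/le_anti ->; rewrite subrr.
exact: lexx.
Unshelve. all: by end_near. Qed.
End AbsContinuousDensity.

(** * Densities, almost everywhere derivatives and the Lebesgue fundamental theorem of calculus *)

Section AbsContinuousFTC.
Context {R : realType}.
Implicit Types (f g : R -> R) (a b e x y : R).
Local Notation mu := (@lebesgue_measure R).

Lemma nondecreasing_density a b g : a <= b -> abs_continuous a b g ->
  {in `[a, b] &, nondecreasing_fun g} ->
  exists2 w : R -> R, mu.-integrable setT (EFin \o w) &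
    forall x, a <= x <= b -> g x - g a = \int[mu]_(t in `]a, x]) w t.
Proof.
move=> ab acg ndg.
have ndG : nondecreasing (g \o clip a b).
  by move=> x y xy /=; apply: ndg; rewrite ?in_itv/= ?clip_in// clip_le.
have rcG : right_continuous (g \o clip a b).
  exact/right_continuousW/abs_continuous_continuous_clip.
pose G : cumulative R R := HB.pack (g \o clip a b)
  (isCumulative.Build R _ R (g \o clip a b) ndG rcG).
have Gc x : G x = G (clip a b x).
  by rewrite /G /= (clip_id (clip_in x ab)).
have acG : abs_continuous a (b + 1) G by exact: abs_continuous_clip.
have dom := lebesgue_stieltjes_dominates ab Gc acG.
have nuT := lebesgue_stieltjes_clip_setT ab Gc.
have nuTfin : (lebesgue_stieltjes_measure G setT < +oo)%E.
  exact: (eq_ind_r (fun z => z < +oo)%E (ltry _) nuT).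
(* Restricting to the whole line changes no value; it packages the Stieltjes measure as a finite
   measure for the Radon-Nikodym theorem. *)
pose nu := mfrestr measurableT nuTfin.
have nuE A : nu A = lebesgue_stieltjes_measure G A.
  by rewrite /nu /mfrestr /mrestr setIT.
have [|f [f0 ffin intf fE]] := @radon_nikodym_sigma_finite _ _ _ mu nu.
  apply/null_content_dominatesP => A mA A0; rewrite [LHS]nuE.
  by move/null_content_dominatesP : dom; exact.
have fw : EFin \o (fine \o f) = f by apply/funext => x /=; rewrite fineK.
exists (fine \o f); first by rewrite fw.
move=> x /andP[ax xb]; apply: EFin_inj.
have := lebesgue_stieltjes_ocitv G ax.
rewrite /G /= clip_id ?ax// clip_id ?lexx// => <-.
rewrite /Rintegral -[X in fine X]/(\int[mu]_(t in `]a, x]) (EFin \o (fine \o f)) t)%E fw.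
rewrite fineK; first by rewrite -fE// nuE.
by apply: integrable_fin_num => //; exact: integrableS intf.
Qed.

Lemma abs_continuous_density a b f : a <= b -> abs_continuous a b f ->
  exists2 w : R -> R, mu.-integrable setT (EFin \o w) &
    forall x, a <= x <= b -> f x - f a = \int[mu]_(t in `]a, x]) w t.
Proof.
move=> ab /abs_continuous_nondecreasingB[g1 [g2 [ac1 ac2 nd1 nd2 ->]]].
have [w1 i1 E1] := nondecreasing_density ab ac1 nd1.
have [w2 i2 E2] := nondecreasing_density ab ac2 nd2.
exists (w1 \- w2); first exact: (integrableB _ i1 i2).
move=> x xab; rewrite /= RintegralB//; last 2 first.
  exact: integrableS i1.
  exact: integrableS i2.
by rewrite -E1// -E2//; ring.
Qed.

Lemma abs_continuous_ae_derivable a b f : a <= b -> abs_continuous a b f ->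
  exists w : R -> R, [/\ mu.-integrable setT (EFin \o w),
    forall x, a <= x <= b -> f x - f a = \int[mu]_(t in `]a, x]) w t &
    {ae mu, forall x, a < x < b -> is_derive x 1 f (w x)}].
Proof.
move=> ab /(abs_continuous_density ab)[w iw Ew]; exists w; split => //.
have locw : locally_integrable setT w.
  by apply: open_integrable_locally => //; exact: openT.
have iwy y : mu.-integrable [set` Interval (BRight a) (BRight y)] (EFin \o w).
  exact: integrableS iw.
have := FTC1 iwy locw.
apply: (@filterS _ _ (ae_filter_ringOfSetsType mu)) => x + /andP[ax xb].
move=> /(_ ax)[dF F'].
set F := (fun _ => _) in dF F'.
(* [F y] is the integral of [w] over []a, y]], hence [f y - f a] as long as [y] stays in
   [[a, b]]. *)
have nearE : \forall y \near x, F y + f a = f y.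
  near=> y; rewrite /F -Ew; first by ring.
  by apply/andP; split; apply: ltW; near: y; [exact: lt_nbhsr|exact: lt_nbhsl].
apply: (near_eq_is_derive nearE); rewrite -[w x]addr0.
by apply: is_deriveD; rewrite -F' derive1E; exact: DeriveDef.
Unshelve. all: by end_near. Qed.

Lemma ae_neq (c : R) : {ae mu, forall x, x != c}.
Proof.
exists [set c]; split => //; first exact: lebesgue_measure_set1.
by move=> x /= /negP/negPn/eqP.
Qed.

Lemma ae_eq_itv_cc a b (u w : R -> R) :
  {ae mu, forall x, a < x < b -> u x = w x} ->
  ae_eq mu `[a, b]%classic (EFin \o u) (EFin \o w).
Proof.
move=> uw; apply: (@filterS3 _ _ (ae_filter_ringOfSetsType mu)) (ae_neq a) (ae_neq b) uw => x xa xb uwx.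
rewrite /= in_itv/= => /andP[ax xb']; congr EFin; apply: uwx.
by rewrite !lt_neqAle ax xb' xb eq_sym xa.
Qed.

Lemma ae_eq_integrable (D : set R) (u w : R -> \bar R) : measurable D ->
  measurable_fun D w -> ae_eq mu D u w ->
  mu.-integrable D u -> mu.-integrable D w.
Proof.
move=> mD mw uw /integrableP[mu_ ufin]; apply/integrableP; split => //.
apply: le_lt_trans ufin; rewrite le_eqVlt; apply/orP; left; apply/eqP.
apply: ae_eq_integral => //.
- exact: measurableT_comp.
- exact: measurableT_comp.
- by apply: (@filterS _ _ (ae_filter_ringOfSetsType mu)) uw => x + Dx => /(_ Dx)/= ->.
Qed.

(** Uniqueness of derivatives identifies [u] almost everywhere with the density [w] of [f], so
    integrability and the integral pass from [w] to [u]. *)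
Lemma abs_continuous_FTC2 a b f u : a <= b -> abs_continuous a b f ->
  measurable_fun `[a, b] u ->
  {ae mu, forall x, a < x < b -> is_derive x 1 f (u x)} ->
  mu.-integrable `[a, b] (EFin \o u) /\
  \int[mu]_(x in `[a, b]) u x = f b - f a.
Proof.
move=> ab acf mu_ fu.
have [w [iw Ew aew]] := abs_continuous_ae_derivable ab acf.
have wu : ae_eq mu `[a, b]%classic (EFin \o w) (EFin \o u).
  apply: ae_eq_itv_cc; apply: (@filterS2 _ _ (ae_filter_ringOfSetsType mu)) aew fu => x h1 h2 xab.
  have := h1 xab; have := h2 xab => d1 d2.
  by rewrite -(@derive_val _ _ _ _ _ _ _ d1) (@derive_val _ _ _ _ _ _ _ d2).
have iwab : mu.-integrable `[a, b] (EFin \o w) by exact: integrableS iw.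
have mEu : measurable_fun `[a, b] (EFin \o u) by exact/measurable_EFinP.
have iu : mu.-integrable `[a, b] (EFin \o u).
  exact: (ae_eq_integrable _ mEu wu).
split => //; rewrite Ew ?lexx ?ab// Rintegral_itv_obnd_cbnd; last first.
  exact: integrableS iw.
rewrite /Rintegral; congr fine.
by apply/esym/ae_eq_integral => //; case/integrableP: iwab.
Qed.

End AbsContinuousFTC.

(** * Derivatives relative to [0, 1] *)

Section Derivative01.
Context {R : realType}.
Implicit Types (f g : R -> R) (a b c d l x y : R).

(** Points just to the right of [x < 1] stay in [[0, 1]], so limits of [dquot01] are also right
    limits. With the left counterpart, this yields uniqueness of such limits and continuity at the
    end points. *)
Lemma within01_at_right x (A : set R) : 0 <= x < 1 ->
  within `[0, 1]%classic x^' A -> x^'+ A.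
Proof.
move=> /andP[x0 x1] hA.
have {}hA : \forall y \near x, y != x -> `[0, 1]%classic y -> A y := hA.
suff : \forall y \near x, x < y -> A y by [].
near=> y => xy; apply: (near hA y) => //=; first by rewrite gt_eqF.
rewrite in_itv/= (le_trans x0 (ltW xy)) ltW//.
by near: y; exact: lt_nbhsl.
Unshelve. all: by end_near. Qed.

Lemma within01_at_left x (A : set R) : 0 < x <= 1 ->
  within `[0, 1]%classic x^' A -> x^'- A.
Proof.
move=> /andP[x0 x1] hA.
have {}hA : \forall y \near x, y != x -> `[0, 1]%classic y -> A y := hA.
suff : \forall y \near x, y < x -> A y by [].
near=> y => xy; apply: (near hA y) => //=; first by rewrite lt_eqF.
rewrite in_itv/= (le_trans (ltW xy) x1) andbT ltW//.
by near: y; exact: lt_nbhsr.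
Unshelve. all: by end_near. Qed.

Lemma within01_proper x : 0 <= x <= 1 -> ProperFilter (within `[0, 1]%classic x^').
Proof.
move=> /andP[x0 x1]; apply: Build_ProperFilter_ex => P hP.
have [lx|lx] := ltP x 1.
  by apply: (@filter_ex _ x^'+); apply: within01_at_right hP; rewrite x0.
apply: (@filter_ex _ x^'-); apply: within01_at_left hP.
by rewrite x1 (lt_le_trans ltr01).
Qed.

Lemma dquot01_cvgP f x l : 0 <= x <= 1 -> dquot01 f x --> l ->
  derivable01 f x /\ deriv01 f x = l.
Proof.
move=> x01 fl; have pf := within01_proper x01.
split; first by apply/cvg_ex; exists l.
exact: cvg_lim.
Qed.

Lemma derivable01_cvg f x : derivable01 f x -> dquot01 f x --> deriv01 f x.
Proof. by []. Qed.

(** In Caratheodory's form, the difference quotient agrees off [x] with a function continuous at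
    [x], hence converges along the filter relative to [[0, 1]] too. *)
Lemma is_derive_deriv01 f x d : 0 <= x <= 1 -> is_derive x 1 f d ->
  derivable01 f x /\ deriv01 f x = d.
Proof.
move=> x01 /is_derive1_caratheodory[g [fg cg gx]].
apply: dquot01_cvgP => //; rewrite /dquot01 -gx.
have h : g y @[y --> x^'] --> g x by exact: cvg_within_filter.
move=> A /h hA; have {}hA : \forall y \near x, y != x -> A (g y) := hA.
suff : \forall y \near x, y != x -> `[0, 1]%classic y ->
  A ((f y - f x) / (y - x)) by [].
by apply: filterS hA => y hy yx _; rewrite fg mulfK ?subr_eq0//; exact: hy.
Qed.

Lemma eq_dquot01 f g x : {in `[0, 1], f =1 g} -> 0 <= x <= 1 ->
  dquot01 f x = dquot01 g x.
Proof.
suff H : forall f g, {in `[0, 1], f =1 g} -> 0 <= x <= 1 ->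
    dquot01 f x `<=` dquot01 g x.
  move=> fg x01; apply/seteqP; split; first exact: H.
  by apply: H => // y y01; rewrite fg.
move=> {}f {}g fg x01 A hA.
have {}hA : \forall y \near x, y != x -> `[0, 1]%classic y ->
  A ((f y - f x) / (y - x)) := hA.
suff : \forall y \near x, y != x -> `[0, 1]%classic y ->
  A ((g y - g x) / (y - x)) by [].
by apply: filterS hA => y hy yx y01; rewrite -!fg//; exact: hy.
Qed.

Lemma eq_deriv01 f g x : {in `[0, 1], f =1 g} -> 0 <= x <= 1 ->
  deriv01 f x = deriv01 g x.
Proof. by move=> fg x01; rewrite /deriv01 (eq_dquot01 fg x01). Qed.

(** Around an interior point, the restriction to [[0, 1]] is eventually vacuous; filling the
    difference quotient at [x] with its limit gives the Caratheodory function. *)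
Lemma deriv01_is_derive f x : 0 < x < 1 -> derivable01 f x ->
  is_derive x 1 f (deriv01 f x).
Proof.
move=> /andP[x0 x1] /derivable01_cvg fl; apply/is_derive1_caratheodory.
exists (fun y => if y == x then deriv01 f x else (f y - f x) / (y - x)); split.
- move=> y; case: eqP => [->|/eqP]; first by rewrite !subrr mulr0.
  by rewrite -subr_eq0 => /divfK->.
- apply/cvgrPdist_lt => e e0; rewrite eqxx.
  move/cvgrPdist_lt : fl => /(_ e e0) h.
  have {}h : \forall y \near x, y != x -> `[0, 1]%classic y ->
    `|deriv01 f x - (f y - f x) / (y - x)| < e := h.
  near=> y; case: eqP => [_|/eqP yx]; first by rewrite subrr normr0.
  apply: (near h y) => //=; rewrite in_itv/=.
  by apply/andP; split; apply: ltW; near: y; [exact: lt_nbhsr|exact: lt_nbhsl].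
- by rewrite eqxx.
Unshelve. all: by end_near. Qed.

Lemma dquot01_cvg_at_right f x l : 0 <= x < 1 -> dquot01 f x --> l ->
  f y @[y --> x^'+] --> f x.
Proof.
move=> x01 fl.
have fr : (f y - f x) / (y - x) @[y --> x^'+] --> l.
  by move=> A /fl; exact: within01_at_right.
(* Multiplying the convergent quotient back by [y - x] recovers [f y] as a limit. *)
have : (f y - f x) / (y - x) * (y - x) + f x @[y --> x^'+] --> l * (x - x) + f x.
  apply: cvgD; last exact: cvg_cst.
  apply: cvgM => //; apply: cvgB; last exact: cvg_cst.
  exact: cvg_within_filter.
rewrite subrr mulr0 add0r; apply: cvg_trans; apply: near_eq_cvg.
by near=> y; rewrite divfK ?subrK// subr_eq0 gt_eqF//.
Unshelve. all: by end_near. Qed.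

Lemma dquot01_cvg_at_left f x l : 0 < x <= 1 -> dquot01 f x --> l ->
  f y @[y --> x^'-] --> f x.
Proof.
move=> x01 fl.
have fr : (f y - f x) / (y - x) @[y --> x^'-] --> l.
  by move=> A /fl; exact: within01_at_left.
have : (f y - f x) / (y - x) * (y - x) + f x @[y --> x^'-] --> l * (x - x) + f x.
  apply: cvgD; last exact: cvg_cst.
  apply: cvgM => //; apply: cvgB; last exact: cvg_cst.
  exact: cvg_within_filter.
rewrite subrr mulr0 add0r; apply: cvg_trans; apply: near_eq_cvg.
by near=> y; rewrite divfK ?subrK// subr_eq0 lt_eqF//.
Unshelve. all: by end_near. Qed.

Lemma derivable01_continuous f : (forall x, 0 <= x <= 1 -> derivable01 f x) ->
  {within `[0, 1], continuous f}.
Proof.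
move=> df; apply/continuous_within_itvP => //; split.
- move=> x; rewrite in_itv/= => x01.
  have [x0 x1] := andP x01.
  have /(deriv01_is_derive x01)[dfx _] := df x (introT andP (conj (ltW x0) (ltW x1))).
  exact/differentiable_continuous/derivable1_diffP.
- apply: (@dquot01_cvg_at_right _ _ (deriv01 f 0)); first by rewrite lexx ltr01.
  by apply/derivable01_cvg/df; rewrite lexx ler01.
- apply: (@dquot01_cvg_at_left _ _ (deriv01 f 1)); first by rewrite lexx ltr01.
  by apply/derivable01_cvg/df; rewrite lexx ler01.
Qed.

Lemma within_continuous_bounded a b f : {within `[a, b], continuous f} ->
  exists M, forall x, a <= x <= b -> `|f x| <= M.
Proof.
move=> cf; have [ab|ba] := leP a b; last first.
  by exists 0 => x /andP[ax xb]; have := le_trans ax xb; rewrite leNgt ba.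
have [c1 _ h1] := EVT_max ab cf; have [c2 _ h2] := EVT_min ab cf.
exists (Num.max `|f c1| `|f c2|) => x xab.
have xab' : x \in `[a, b] by rewrite in_itv.
rewrite ler_norml; apply/andP; split.
  rewrite lerNl; apply: (@le_trans _ _ (- f c2)); first by rewrite lerN2 h2.
  by rewrite le_max -(normrN (f c2)) ler_norm orbT.
by apply: (le_trans (h1 _ xab')); rewrite le_max ler_norm.
Qed.

(** The mean value theorem makes [f] Lipschitz with constant [M]. *)
Lemma bounded_derive_abs_continuous a b f (df : R -> R) M :
  {within `[a, b], continuous f} ->
  (forall x, a < x < b -> is_derive x 1 f (df x)) ->
  (forall x, a < x < b -> `|df x| <= M) -> abs_continuous a b f.
Proof.
move=> cf fdf dfM; apply: (@lipschitz_abs_continuous _ _ _ _ M) => x y ax.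
rewrite le_eqVlt => /predU1P[->|xy yb]; first by rewrite !subrr normr0 mulr0.
have [||c + ->] := @MVT _ f df x y xy.
- move=> z; rewrite in_itv/= => /andP[xz zy]; apply: fdf.
  by rewrite (le_lt_trans ax)// (lt_le_trans zy).
- by apply: continuous_subspaceW cf; apply: subset_itv; rewrite bnd_simp.
rewrite in_itv/= => /andP[xc cy]; rewrite normrM [X in _ * X]gtr0_norm ?subr_gt0//.
rewrite ler_wpM2r ?subr_ge0 ?(ltW xy)// dfM//.
by rewrite (le_lt_trans ax)// (lt_le_trans cy).
Qed.

Lemma abs_continuous_within a b f : a <= b -> abs_continuous a b f ->
  {within `[a, b], continuous f}.
Proof.
move=> ab acf; apply: (@subspace_eq_continuous _ _ _ (f \o clip a b)).
  by move=> x; rewrite inE/= in_itv/= => xab; rewrite clip_id.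
exact/continuous_subspaceT/abs_continuous_continuous_clip.
Qed.

End Derivative01.

(** * Integration by parts for functions of [sobolev2] *)

Section Sobolev.
Context {R : realType}.
Implicit Types (f g phi psi K : R -> R) (a b c d e l m x y : R).
Local Notation mu := (@lebesgue_measure R).

Lemma within_continuous_measurable a b f : {within `[a, b], continuous f} ->
  measurable_fun `[a, b] f.
Proof. by move=> cf; exact: subspace_continuous_measurable_fun. Qed.

Lemma within_continuous_integrable a b f : {within `[a, b], continuous f} ->
  mu.-integrable `[a, b] (EFin \o f).
Proof.
by move=> cf; apply: continuous_compact_integrable => //; exact: segment_compact.
Qed.

Lemma sobolev2_continuous phi : sobolev2 phi ->
  {within `[0, 1], continuous phi} /\ {within `[0, 1], continuous (deriv01 phi)}.
Proof.
move=> [dphi acphi _]; split; first exact: derivable01_continuous.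
by apply: abs_continuous_within.
Qed.

Lemma sobolev2_measurable phi : sobolev2 phi ->
  measurable_fun `[(0 : R), 1] (deriv01 (deriv01 phi)).
Proof.
move=> [_ _ /andP[]]; rewrite inE/= => mf _.
by apply/measurable_restrictT.
Qed.

Lemma sobolev2_integrable_sqr phi : sobolev2 phi ->
  mu.-integrable `[0, 1] (EFin \o (fun x => deriv01 (deriv01 phi) x ^+ 2)).
Proof.
move=> [_ _ /Lfun2_integrable_sqr h].
have : mu.-integrable `[(0 : R), 1]
    (EFin \o (fun x => (deriv01 (deriv01 phi) \_ `[0, 1]) x ^+ 2)).
  exact: integrableS h.
by apply: eq_integrable => // x x01; rewrite /= patchE x01.
Qed.

(** By the equation for [K], the derivative of [K psi - (x - m) phi] is [K (psi' + e psi) - phi],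
    since the terms in [(x - m) psi] cancel. The parameter [e] is [0] for the Euler-Maclaurin kernel
    and [1] for the other one. *)
Lemma sobolev2_parts phi a b m e K : sobolev2 phi -> 0 <= a -> a < b -> b <= 1 ->
  (forall x, is_derive x 1 K (e * K x + (x - m))) ->
  let psi := deriv01 phi in
  mu.-integrable `[a, b] (EFin \o (fun x => K x * (deriv01 psi x + e * psi x))) /\
  \int[mu]_(x in `[a, b]) (K x * (deriv01 psi x + e * psi x)) =
    K b * psi b - K a * psi a - ((b - m) * phi b - (a - m) * phi a) +
    \int[mu]_(x in `[a, b]) phi x.
Proof.
move=> sphi a0 ab b1 dK psi.
have [cphi cpsi] := sobolev2_continuous sphi.
have mpsi2 := sobolev2_measurable sphi.
have [dphi acpsi _] := sphi.
have sub01 : `[a, b]%classic `<=` `[(0 : R), 1]%classic.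
  by apply: subset_itv; rewrite bnd_simp.
have cphi' : {within `[a, b], continuous phi} := continuous_subspaceW sub01 cphi.
have cpsi' : {within `[a, b], continuous psi} := continuous_subspaceW sub01 cpsi.
have cK : continuous K.
  move=> x; have [dKx _] := dK x.
  exact/differentiable_continuous/derivable1_diffP.
have cdK : continuous (fun x => e * K x + (x - m)).
  move=> x; apply: cvgD; first by apply: cvgM; [exact: cvg_cst|exact: cK].
  by apply: cvgB; [exact: cvg_id|exact: cvg_cst].
have [MK hMK] := within_continuous_bounded (continuous_subspaceT cK : {within `[a, b], continuous K}).
have [MdK hMdK] := within_continuous_bounded (continuous_subspaceT cdK : {within `[a, b], continuous _}).
have [Mphi hMphi] := within_continuous_bounded cphi'.
have [Mpsi hMpsi] := within_continuous_bounded cpsi'.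
have oo_cc x : a < x < b -> a <= x <= b by move=> /andP[/ltW-> /ltW->].
have acK : abs_continuous a b K.
  exact: (bounded_derive_abs_continuous (continuous_subspaceT cK) (fun x _ => dK x)
    (fun x h => hMdK x (oo_cc x h))).
have oo01 x : a < x < b -> 0 < x < 1.
  by move=> /andP[ax xb]; rewrite (le_lt_trans a0)// (lt_le_trans xb).
have cc01 x : a <= x <= b -> 0 <= x <= 1.
  by move=> /andP[ax xb]; rewrite (le_trans a0)// (le_trans xb).
have dphi' x : a < x < b -> is_derive x 1 phi (psi x).
  by move=> xab; apply: deriv01_is_derive; [exact: oo01|exact/dphi/cc01/oo_cc].
have acphi : abs_continuous a b phi.
  apply: (bounded_derive_abs_continuous cphi' dphi') => x /oo_cc; exact: hMpsi.
have acid : abs_continuous a b (fun x => x - m).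
  apply: (@lipschitz_abs_continuous _ _ _ _ 1) => x y _ xy _.
  by rewrite mul1r (_ : _ - _ = y - x); [rewrite ger0_norm ?subr_ge0|ring].
have cid : {within `[a, b], continuous (fun x => x - m)} := abs_continuous_within (ltW ab) acid.
have [Mid hMid] := within_continuous_bounded cid.
(* The product rule for absolute continuity asks for one bound valid for both factors. *)
pose M := Num.max (Num.max MK Mpsi) (Num.max Mid Mphi).
have acG : abs_continuous a b ((K \* psi) \- ((fun x => x - m) \* phi)).
  apply: abs_continuousB.
    apply: (@abs_continuousM _ _ _ _ _ M) => //; last exact: abs_continuousW acpsi.
      by move=> x /hMK h; rewrite (le_trans h)// !le_max lexx.
    by move=> x /hMpsi h; rewrite (le_trans h)// !le_max lexx !orbT.
  apply: (@abs_continuousM _ _ _ _ _ M) => //.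
    by move=> x /hMid h; rewrite (le_trans h)// !le_max lexx !orbT.
  by move=> x /hMphi h; rewrite (le_trans h)// !le_max lexx !orbT.
pose u x := K x * (deriv01 psi x + e * psi x).
have mu_ : measurable_fun `[a, b] u.
  apply: measurable_funM.
    by apply: within_continuous_measurable; exact: continuous_subspaceT.
  apply: measurable_funD.
    by apply: measurable_funS mpsi2.
  by apply: measurable_funM => //; exact: within_continuous_measurable.
have aeG : {ae mu, forall x, a < x < b ->
    is_derive x 1 ((K \* psi) \- ((fun x => x - m) \* phi)) (u x - phi x)}.
  (* The density [w] serves only to show that [psi] is differentiable almost everywhere; at such
     points the derivative is [deriv01 psi]. *)
  have [w [_ _ aew]] := abs_continuous_ae_derivable ler01 acpsi.
  apply: (@filterS _ _ (ae_filter_ringOfSetsType mu) _ _ _ aew) => x h xab.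
  have dpsi : is_derive x 1 psi (deriv01 psi x).
    have dw := h (oo01 _ xab).
    by have [_ ->] := is_derive_deriv01 (cc01 _ (oo_cc _ xab)) dw.
  have dphix := dphi' x xab.
  have dKx := dK x.
  have d1 : is_derive x 1 (fun x => x - m) (1 : R).
    by apply: is_derive_eq; rewrite subr0.
  apply: (is_derive_eq (is_deriveB (is_deriveM dKx dpsi) (is_deriveM d1 dphix))); rewrite /u /GRing.scale/=.
  ring.
have iphi := within_continuous_integrable cphi'.
have muphi : measurable_fun `[a, b] (fun x => u x - phi x).
  by apply: measurable_funB => //; exact: within_continuous_measurable.
have [iu Eu] := abs_continuous_FTC2 (ltW ab) acG muphi aeG.
have uE x : u x = (u x - phi x) + phi x by rewrite subrK.
have iu' : mu.-integrable `[a, b] (EFin \o u).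
  have : mu.-integrable `[a, b] ((EFin \o (fun x => u x - phi x)) \+ (EFin \o phi)).
    exact: integrableD.
  by apply: eq_integrable => // x _; rewrite /= -EFinD subrK.
split => //.
rewrite -[LHS]/(\int[mu]_(x in `[a, b]) u x).
under eq_Rintegral do rewrite uE.
by rewrite RintegralD// Eu /=; congr (_ + _); ring.
Qed.

End Sobolev.

(** * Peano kernels *)

Section Kernels.
Context {R : realType}.
Implicit Types (f g u phi psi : R -> R) (a b c d e h m x y : R).
Local Notation mu := (@lebesgue_measure R).

(** With [h = b - a] and [t = (x - a) / h], this is [h ^ 2 / 2] times the Bernoulli polynomial
    [t ^ 2 - t + 1 / 6]. *)
Definition kerEM a b x : R := (x - a) * (x - b) / 2 + (b - a) ^+ 2 / 12.

(** With [m] the midpoint, [- 1 - (x - m)] is a particular solution of [K' = K + (x - m)]; the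
    coefficient of the exponential is the one that equalizes the end values. *)
Definition kerOpt a b x : R :=
  (b - a) / (expR (b - a) - 1) * expR (x - a) - 1 - (x - (a + b) / 2).

Lemma is_derive_shift_sub a x : is_derive x 1 (fun x => x - a) (1 : R).
Proof. by apply: is_derive_eq; rewrite subr0. Qed.

(** The vanishing first summand gives the derivative the shape required by [sobolev2_parts], with
    [e = 0]. *)
Lemma is_derive_kerEM a b x :
  is_derive x 1 (kerEM a b) (0 * kerEM a b x + (x - (a + b) / 2)).
Proof.
have da := is_derive_shift_sub a x; have db := is_derive_shift_sub b x.
have := is_deriveD (is_deriveM (is_deriveM da db) (is_derive_cst (2^-1 : R) x 1))
  (is_derive_cst ((b - a) ^+ 2 / 12) x 1).
move=> H; apply: (is_derive_eq H).
by rewrite /GRing.scale/= /kerEM; field.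
Qed.

Lemma is_derive_kerOpt a b x :
  is_derive x 1 (kerOpt a b) (1 * kerOpt a b x + (x - (a + b) / 2)).
Proof.
have da := is_derive_shift_sub a x.
have dm := is_derive_shift_sub ((a + b) / 2) x.
have de : is_derive x 1 (expR \o (fun x => x - a)) (expR (x - a) * 1).
  exact: is_derive1_comp.
pose C := (b - a) / (expR (b - a) - 1).
have H := is_deriveB (is_deriveB (is_deriveM (is_derive_cst C x 1) de)
  (is_derive_cst (1 : R) x 1)) dm.
apply: (is_derive_eq H).
by rewrite /kerOpt -/C /GRing.scale/= ; ring.
Qed.

Lemma kerEM_ends a b : kerEM a b a = (b - a) ^+ 2 / 12 /\ kerEM a b b = (b - a) ^+ 2 / 12.
Proof. by rewrite /kerEM; split; ring. Qed.

(** When [b - a] is the mesh size, [c] is the coefficient [C1 N 0] of the quadrature formula. *)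
Lemma kerOpt_ends a b : a < b ->
  let h := b - a in let c := h * (expR h + 1) / (2 * (expR h - 1)) - 1 in
  kerOpt a b a = c /\ kerOpt a b b = c.
Proof.
move=> ab h c; have e1 : expR h - 1 != 0.
  by rewrite subr_eq0 gt_eqF// expR_gt1 subr_gt0.
rewrite /kerOpt subrr expR0 -/h /c.
have -> : a - (a + b) / 2 = - (h / 2) by rewrite /h; field.
have -> : b - (a + b) / 2 = h / 2 by rewrite /h; field.
by split; field.
Qed.

Lemma derivable_all_continuous f (df : R -> R) : (forall x, is_derive x 1 f (df x)) ->
  continuous f.
Proof.
by move=> fd x; have [dfx _] := fd x; exact/differentiable_continuous/derivable1_diffP.
Qed.

Lemma continuous_kerEM a b : continuous (kerEM a b).
Proof. exact: derivable_all_continuous (is_derive_kerEM a b). Qed.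

Lemma continuous_kerOpt a b : continuous (kerOpt a b).
Proof. exact: derivable_all_continuous (is_derive_kerOpt a b). Qed.

Lemma continuous_sqr f : continuous f -> continuous (fun x => f x ^+ 2).
Proof. by move=> cf x; apply: cvgM; exact: cf. Qed.

Lemma continuous_integrable a b f : continuous f -> mu.-integrable `[a, b] (EFin \o f).
Proof.
move=> cf; apply: within_continuous_integrable; exact: continuous_subspaceT.
Qed.

Lemma is_derive_near0 f a b x d : (forall y, a < y < b -> f y = 0) -> a < x < b ->
  is_derive x 1 f d -> d = 0.
Proof.
move=> f0 /andP[ax xb] fd.
have : is_derive x 1 (cst (0 : R)) d.
  apply: near_eq_is_derive fd; near=> y; apply: f0.
  by apply/andP; split; near: y; [exact: lt_nbhsr|exact: lt_nbhsl].
move=> /@derive_val <-.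
by rewrite derive_cst.
Unshelve. all: by end_near. Qed.

(** The primitive of [f ^ 2] is nonnegative and at most the full integral, so it vanishes on the
    interval, and so does its derivative [f ^ 2]. *)
Lemma Rintegral_sqr_continuous_eq0 f a b : continuous f ->
  \int[mu]_(x in `[a, b]) (f x ^+ 2) = 0 -> forall x, a < x < b -> f x = 0.
Proof.
move=> cf I0 x xab; have [ax xb] := andP xab.
pose f2 x := f x ^+ 2.
have cf2 : continuous f2 by exact: continuous_sqr.
pose F y := \int[mu]_(t in `[a, y]) f2 t.
have F0 y : a < y < b -> F y = 0.
  move=> /andP[ay yb]; apply/eqP; rewrite eq_le Rintegral_ge0 ?andbT; last first.
    by move=> t _; exact: sqr_ge0.
  rewrite -I0 -subr_ge0 /F Rintegral_itvB ?bnd_simp ?(ltW ay) ?(ltW yb)//.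
    by apply: Rintegral_ge0 => t _; exact: sqr_ge0.
  exact: continuous_integrable.
have [dF F'] := @continuous_FTC1_closed _ f2 a x b xb (continuous_integrable a b cf2) ax (cf2 x).
have fd : is_derive x 1 F (f2 x).
  by rewrite -F' derive1E; exact: DeriveDef.
by have /eqP := is_derive_near0 F0 xab fd; rewrite /f2 sqrf_eq0 => /eqP.
Qed.

(* With D the difference of the kernels, D' = kerOpt, so kerEM^2 = kerOpt^2 +
   D^2 - (D^2)', and D takes the same value at both end points. *)
Lemma kerOpt_lt_kerEM a b : a < b ->
  \int[mu]_(x in `[a, b]) (kerOpt a b x ^+ 2) <
  \int[mu]_(x in `[a, b]) (kerEM a b x ^+ 2).
Proof.
move=> ab; pose D x := kerOpt a b x - kerEM a b x.
have dD x : is_derive x 1 D (kerOpt a b x).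
  apply: (is_derive_eq (is_deriveB (is_derive_kerOpt a b x) (is_derive_kerEM a b x))).
  by rewrite mul1r mul0r add0r addrK.
have cD : continuous D by exact: derivable_all_continuous dD.
have cO := @continuous_kerOpt a b; have cE := @continuous_kerEM a b.
have cD2 : continuous (fun x => D x ^+ 2) by exact: continuous_sqr.
have cO2 : continuous (fun x => kerOpt a b x ^+ 2) by exact: continuous_sqr.
have cE2 : continuous (fun x => kerEM a b x ^+ 2) by exact: continuous_sqr.
have dD2 x : is_derive x 1 (fun x => D x ^+ 2) (2 * D x * kerOpt a b x).
  apply: (is_derive_eq (is_deriveX 2 (dD x))).
  by rewrite /GRing.scale/= expr1; ring.
have cdD2 : continuous (fun x => 2 * D x * kerOpt a b x).
  move=> x; apply: cvgM; last exact: cO.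
  by apply: cvgM; [exact: cvg_cst|exact: cD].
have I0 : \int[mu]_(x in `[a, b]) (2 * D x * kerOpt a b x) = 0.
  rewrite /Rintegral (@continuous_FTC2 _ _ (fun x => D x ^+ 2))//=.
  - have [Ea Eb] := kerEM_ends a b; have [Oa Ob] := kerOpt_ends ab.
    by rewrite /D Ea Eb Oa Ob subrr.
  - exact: continuous_subspaceT.
  - split.
    + by move=> x _; have [] := dD2 x.
    + by apply: cvg_at_right_filter; exact: cD2.
    + by apply: cvg_at_left_filter; exact: cD2.
  - by move=> x _; rewrite derive1E; have [_ ->] := dD2 x.
have E2 x : kerEM a b x ^+ 2 = (kerOpt a b x ^+ 2 + D x ^+ 2) - 2 * D x * kerOpt a b x.
  by rewrite /D; ring.
under [ltRHS]eq_Rintegral do rewrite E2.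
have iO2 := @continuous_integrable a b _ cO2.
have iD2 := @continuous_integrable a b _ cD2.
rewrite RintegralB//; last 2 first.
  by apply: continuous_integrable => x; apply: cvgD; [exact: cO2|exact: cD2].
  exact: continuous_integrable.
rewrite I0 subr0 RintegralD// ltrDl lt_neqAle Rintegral_ge0 ?andbT; last first.
  by move=> x _; exact: sqr_ge0.
(* In the case of equality [D] would vanish, hence also its derivative [kerOpt], and the equation of
   [kerOpt] would force every interior point to be the midpoint; the point [x] below is not. *)
apply/eqP => /esym /(Rintegral_sqr_continuous_eq0 cD) D0.
have O0 x : a < x < b -> kerOpt a b x = 0.
  by move=> xab; exact: (is_derive_near0 D0 xab (dD x)).
pose x := a + (b - a) / 4.
have xab : a < x < b by rewrite /x; lra.
have := is_derive_near0 O0 xab (is_derive_kerOpt a b x).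
rewrite O0// mulr0 add0r /x => /eqP; rewrite subr_eq0 => /eqP; lra.
Qed.

Lemma Rintegral_sum_itv (t : nat -> R) n u : {homo t : i j / (i <= j)%N >-> i <= j} ->
  mu.-integrable `[t 0%N, t n] (EFin \o u) ->
  \int[mu]_(x in `[t 0%N, t n]) u x =
  \sum_(k < n) \int[mu]_(x in `[t k, t k.+1]) u x.
Proof.
move=> tm; elim: n => [|n ih] iu.
  by rewrite big_ord0 set_itv1 Rintegral_set1.
have t0n : t 0%N <= t n by exact: tm.
have tn : t n <= t n.+1 by exact: tm.
have sub1 : `[t 0%N, t n]%classic `<=` `[t 0%N, t n.+1]%classic.
  by apply: subset_itvl; rewrite bnd_simp.
have sub2 : `]t n, t n.+1]%classic `<=` `[t 0%N, t n.+1]%classic.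
  by apply: subset_itvr; rewrite bnd_simp.
rewrite big_ord_recr /= -ih; last exact: integrableS iu.
rewrite -(@Rintegral_itv_obnd_cbnd _ (t n)); last exact: integrableS iu.
by rewrite -(Rintegral_itvB iu) ?bnd_simp// addrCA subrr addr0.
Qed.

End Kernels.

(** * Kernel representations of the error functionals and the upper bound *)

Section ErrorFunctionals.
Context {R : realType}.
Implicit Types (f g u phi psi : R -> R) (a b c d e h m x y : R) (N k : nat).
Local Notation mu := (@lebesgue_measure R).

Definition knot N k : R := step N * k%:R.

Lemma knot_mono N : {homo knot N : i j / (i <= j)%N >-> i <= j}.
Proof. by move=> i j ij; rewrite /knot ler_wpM2l ?ler_nat// invr_ge0. Qed.

Lemma knotS N k : knot N k.+1 - knot N k = step N.
Proof. by rewrite /knot -natr1 mulrDr mulr1 addrAC subrr add0r. Qed.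

Lemma knot0 N : knot N 0 = 0. Proof. by rewrite /knot mulr0. Qed.

Lemma knotN N : (0 < N)%N -> knot N N = 1.
Proof. by move=> N0; rewrite /knot /step mulVf// pnatr_eq0 -lt0n. Qed.

Lemma step_gt0 N : (0 < N)%N -> 0 < step N :> R.
Proof. by move=> N0; rewrite /step invr_gt0 ltr0n. Qed.

Lemma knot_lt N k : (0 < N)%N -> knot N k < knot N k.+1.
Proof. by move=> N0; rewrite -subr_gt0 knotS step_gt0. Qed.

(** Regroups the nodes by mesh intervals: an interior node receives half a step from each of its two
    neighbours, an end node from one only. *)
Lemma sum_C0 N (f : nat -> R) : (0 < N)%N ->
  \sum_(i < N.+1) C0 N i * f i = \sum_(k < N) step N / 2 * (f k + f k.+1).
Proof.
case: N => // M _; set h := step M.+1.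
rewrite big_ord_recl big_ord_recr /= /C0 /= eqxx -/h.
rewrite (eq_bigr (fun i : 'I_M => h / 2 * f i.+1 + h / 2 * f i.+1)); last first.
  move=> i _; rewrite /bump /= add1n eqSS (ltn_eqF (ltn_ord i)).
  by field.
rewrite /bump /= add1n big_split/=.
under [RHS]eq_bigr do rewrite mulrDr.
rewrite [RHS]big_split/= big_ord_recl [X in _ = _ + X]big_ord_recr /=.
under [in RHS]eq_bigr do rewrite /bump /= add1n.
by rewrite /=; ring.
Qed.

Lemma sum_C1 N (g : nat -> R) : (0 < N)%N ->
  \sum_(i < N.+1) C1 N i * g i = C1 N 0 * (g 0%N - g N).
Proof.
case: N => // M _.
rewrite big_ord_recl big_ord_recr /= big1; last first.
  by move=> i _; rewrite /C1 /bump /= add1n eqSS (ltn_eqF (ltn_ord i)) mul0r.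
by rewrite /C1 /bump /= add1n eqxx; ring.
Qed.

(** Sums [sobolev2_parts] over the mesh. The common end value [c] makes the terms in [psi]
    telescope, and the distances of the knots to the midpoints, half a step each, produce the
    trapezoidal weights [C0]. *)
Lemma sum_parts N phi e c (K : nat -> R -> R) : (0 < N)%N -> sobolev2 phi ->
  (forall k x, is_derive x 1 (K k) (e * K k x + (x - (knot N k + knot N k.+1) / 2))) ->
  (forall k, K k (knot N k) = c /\ K k (knot N k.+1) = c) ->
  let psi := deriv01 phi in
  \sum_(k < N) \int[mu]_(x in `[knot N k, knot N k.+1])
      (K k x * (deriv01 psi x + e * psi x)) =
  \int[mu]_(x in `[0, 1]) phi x - \sum_(i < N.+1) C0 N i * phi (knot N i)
    - c * (psi 0 - psi 1).
Proof.
move=> N0 sphi dK Kc psi.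
have [cphi _] := sobolev2_continuous sphi.
have E (k : 'I_N) : \int[mu]_(x in `[knot N k, knot N k.+1])
      (K k x * (deriv01 psi x + e * psi x)) =
    c * (psi (knot N k.+1) - psi (knot N k))
    - step N / 2 * (phi (knot N k) + phi (knot N k.+1))
    + \int[mu]_(x in `[knot N k, knot N k.+1]) phi x.
  have k0 : 0 <= knot N k by rewrite -(knot0 N) knot_mono.
  have k1 : knot N k.+1 <= 1 by rewrite -(knotN N0) knot_mono.
  have [_ ->] := sobolev2_parts sphi k0 (knot_lt k N0) k1 (dK k).
  have [-> ->] := Kc k; rewrite -(knotS N k) -/psi.
  by congr (_ + _); field.
under eq_bigr do rewrite E.
rewrite big_split/= sumrB -mulr_sumr.
rewrite -(big_mkord predT (fun k => psi (knot N k.+1) - psi (knot N k))).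
rewrite telescope_sumr// knot0 knotN// (sum_C0 (phi \o knot N))//.
have := @Rintegral_sum_itv _ (knot N) N phi (@knot_mono N).
rewrite knot0 knotN// => -> //; last exact: within_continuous_integrable.
by ring.
Qed.

Lemma ell_EM_kernel N phi : (0 < N)%N -> sobolev2 phi ->
  ell_EM N phi = \sum_(k < N) \int[mu]_(x in `[knot N k, knot N k.+1])
    (kerEM (knot N k) (knot N k.+1) x * deriv01 (deriv01 phi) x).
Proof.
move=> N0 sphi; rewrite /ell_EM.
have Kc k : kerEM (knot N k) (knot N k.+1) (knot N k) = step N ^+ 2 / 12 /\
    kerEM (knot N k) (knot N k.+1) (knot N k.+1) = step N ^+ 2 / 12.
  by have := kerEM_ends (knot N k) (knot N k.+1); rewrite knotS.
have /= <- := sum_parts N0 sphi (fun k x => is_derive_kerEM (knot N k) (knot N k.+1) x) Kc.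
by apply: eq_bigr => k _; apply: eq_Rintegral => x _; rewrite mul0r addr0.
Qed.

Lemma ell_opt_kernel N phi : (0 < N)%N -> sobolev2 phi ->
  ell_opt N phi = \sum_(k < N) \int[mu]_(x in `[knot N k, knot N k.+1])
    (kerOpt (knot N k) (knot N k.+1) x *
      (deriv01 (deriv01 phi) x + deriv01 phi x)).
Proof.
move=> N0 sphi; rewrite /ell_opt big_split/= -/(knot N _).
have -> := sum_C1 (deriv01 phi \o knot N) N0; rewrite /= knot0 knotN// opprD addrA.
have Kc k : kerOpt (knot N k) (knot N k.+1) (knot N k) = C1 N 0 /\
    kerOpt (knot N k) (knot N k.+1) (knot N k.+1) = C1 N 0.
  by have := kerOpt_ends (knot_lt k N0); rewrite knotS.
have /= <- := sum_parts N0 sphi (fun k x => is_derive_kerOpt (knot N k) (knot N k.+1) x) Kc.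
by apply: eq_bigr => k _; apply: eq_Rintegral => x _; rewrite mul1r.
Qed.

Lemma sobolev2_integrable_W21 phi : sobolev2 phi ->
  measurable_fun `[(0 : R), 1] (fun x => deriv01 (deriv01 phi) x + deriv01 phi x) /\
  mu.-integrable `[0, 1]
    (EFin \o (fun x => (deriv01 (deriv01 phi) x + deriv01 phi x) ^+ 2)).
Proof.
move=> sphi; have [_ cpsi] := sobolev2_continuous sphi.
have mg : measurable_fun `[(0 : R), 1] (fun x => deriv01 (deriv01 phi) x + deriv01 phi x).
  apply: measurable_funD; first exact: sobolev2_measurable.
  exact: within_continuous_measurable.
split => //.
have i1 := sobolev2_integrable_sqr sphi.
have i2 : mu.-integrable `[0, 1] (EFin \o (fun x => deriv01 phi x ^+ 2)).
  apply: within_continuous_integrable => x.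
  by apply: cvgM; exact: cpsi.
pose A := EFin \o (fun x => deriv01 (deriv01 phi) x ^+ 2).
pose B := EFin \o (fun x => deriv01 phi x ^+ 2).
(* Dominating function from [(p + q) ^ 2 <= 2 (p ^ 2 + q ^ 2)], where the gap is [(p - q) ^ 2]. *)
have i3 : mu.-integrable `[0, 1] (fun x => 2%:E * (A x + B x))%E.
  by apply: integrableZl => //; exact: integrableD.
apply: le_integrable i3 => //.
  by apply/measurable_EFinP; exact: measurable_funX.
move=> x _; rewrite /A /B /= lee_fin.
set p := deriv01 _ x; set q := deriv01 phi x.
rewrite !ger0_norm ?sqr_ge0//; last by rewrite mulr_ge0// addr_ge0// sqr_ge0.
rewrite -subr_ge0 (_ : _ - _ = (p - q) ^+ 2); [exact: sqr_ge0|ring].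
Qed.

(** This form of the Cauchy-Schwarz inequality with a free parameter [S] is linear in both square
    integrals, so it can be added up over the mesh. It comes from [(p - S q) ^ 2 >= 0] with [p] and
    [q] the absolute values of the factors. *)
Lemma Rintegral_young a b (K g : R -> R) (S : R) : 0 < S ->
  {within `[a, b], continuous K} -> measurable_fun `[a, b] g ->
  mu.-integrable `[a, b] (EFin \o (fun x => g x ^+ 2)) ->
  `|\int[mu]_(x in `[a, b]) (K x * g x)| <=
    (2 * S)^-1 * \int[mu]_(x in `[a, b]) (K x ^+ 2) +
    S / 2 * \int[mu]_(x in `[a, b]) (g x ^+ 2).
Proof.
move=> S0 cK mg ig.
have iK : mu.-integrable `[a, b] (EFin \o (fun x => K x ^+ 2)).
  by apply: within_continuous_integrable => x; apply: cvgM; exact: cK.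
have iZK : mu.-integrable `[a, b] (EFin \o (fun x => (2 * S)^-1 * K x ^+ 2)).
  by apply: (integrableZl _ (2 * S)^-1 iK).
have iZg : mu.-integrable `[a, b] (EFin \o (fun x => S / 2 * g x ^+ 2)).
  by apply: (integrableZl _ (S / 2) ig).
have iB : mu.-integrable `[a, b]
    (EFin \o (fun x => (2 * S)^-1 * K x ^+ 2 + S / 2 * g x ^+ 2)).
  by have : mu.-integrable `[a, b] ((EFin \o (fun x => (2 * S)^-1 * K x ^+ 2)) \+
    (EFin \o (fun x => S / 2 * g x ^+ 2))) by exact: integrableD.
have le x : `|K x * g x| <= (2 * S)^-1 * K x ^+ 2 + S / 2 * g x ^+ 2.
  rewrite normrM -(real_normK (num_real (K x))) -(real_normK (num_real (g x))).
  set p := `|K x|; set q := `|g x|.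
  rewrite -subr_ge0 [leRHS](_ : _ = (2 * S)^-1 * (p - S * q) ^+ 2); last first.
    by field; rewrite gt_eqF.
  by rewrite mulr_ge0 ?sqr_ge0// invr_ge0 mulr_ge0 ?ltW.
have iKg : mu.-integrable `[a, b] (EFin \o (fun x => K x * g x)).
  apply: le_integrable iB => //.
    apply/measurable_EFinP; apply: measurable_funM => //.
    exact: within_continuous_measurable.
  by move=> x _ /=; rewrite lee_fin (le_trans (le x))// ler_norm.
apply: (le_trans (le_normr_Rintegral _ iKg)) => //.
rewrite -RintegralZl// -RintegralZl// -RintegralD//.
apply: le_Rintegral => //.
pose A := EFin \o (fun x => K x * g x).
suff : mu.-integrable `[a, b] (abse \o A) by [].
exact: integrable_abse.
Qed.

(** Young's inequality summed over the mesh, where the integrals of [g ^ 2] add up to [1]. The bound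
    is uniform in [phi], so it passes to the supremum. *)
Lemma ell_opt_le N phi (S : R) : (0 < N)%N -> 0 < S -> sobolev2 phi -> W21_norm phi = 1 ->
  `|ell_opt N phi| <= (2 * S)^-1 * (\sum_(k < N)
    \int[mu]_(x in `[knot N k, knot N k.+1]) (kerOpt (knot N k) (knot N k.+1) x ^+ 2))
    + S / 2.
Proof.
move=> N0 S0 sphi; rewrite /W21_norm => n1.
have [mg ig] := sobolev2_integrable_W21 sphi.
set g := (fun x => deriv01 (deriv01 phi) x + deriv01 phi x) in mg.
have I1 : \int[mu]_(x in `[0, 1]) (g x ^+ 2) = 1.
  rewrite -[LHS]sqr_sqrtr; last by apply: Rintegral_ge0 => x _; exact: sqr_ge0.
  by rewrite n1 expr1n.
rewrite ell_opt_kernel// (le_trans (ler_norm_sum _ _ _))//.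
have -> : S / 2 = S / 2 * \int[mu]_(x in `[0, 1]) (g x ^+ 2) by rewrite I1 mulr1.
have := @Rintegral_sum_itv _ (knot N) N (fun x => g x ^+ 2) (@knot_mono N).
rewrite knot0 knotN// => -> //.
rewrite !mulr_sumr -big_split/=; apply: ler_sum => k _.
have sub01 : `[knot N k, knot N k.+1]%classic `<=` `[(0 : R), 1]%classic.
  apply: subset_itv; rewrite bnd_simp.
    by rewrite -(knot0 N) knot_mono.
  by rewrite -(knotN N0) knot_mono.
apply: Rintegral_young => //.
- exact/continuous_subspaceT/continuous_kerOpt.
- exact: measurable_funS mg.
- exact: integrableS ig.
Qed.

End ErrorFunctionals.

(** * An extremal function for the Euler-Maclaurin functional *)

Section Extremal.
Context {R : realType}.
Implicit Types (f g phi : R -> R) (a b c d x y : R) (N k : nat).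
Local Notation mu := (@lebesgue_measure R).

Lemma continuous_primitive c d f : {within `[c, d], continuous f} ->
  exists F, forall x, c < x < d -> is_derive x 1 F (f x).
Proof.
move=> cf; exists (fun y => \int[mu]_(t in `[c, y]) f t) => x xcd.
have [cx xd] := andP xcd.
have [cfoo _ _] := (continuous_within_itvP _ (lt_trans cx xd)).1 cf.
have [dF <-] := @continuous_FTC1_closed _ f c x d xd
  (within_continuous_integrable cf) cx (cfoo x xcd).
by rewrite derive1E; exact: DeriveDef.
Qed.

Lemma continuous_Lfun2 f : continuous f -> f \_ `[0, 1] \in Lfun mu 2%:E.
Proof.
move=> cf; have mf : measurable_fun setT (f \_ `[(0 : R), 1]).
  apply/(measurable_restrictT _ _).1 => //.
  by apply: within_continuous_measurable; exact: continuous_subspaceT.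
rewrite inE; apply/andP; split; rewrite inE//=.
rewrite /finite_norm unlock poweR_lty//.
have := continuous_integrable 0 1 (continuous_sqr cf).
move=> /integrableP[_]; apply: le_lt_trans.
rewrite [leRHS]integral_mkcond le_eqVlt; apply/orP; left; apply/eqP.
apply: eq_integral => x _; rewrite /= !patchE; case: ifPn => _ /=.
  by rewrite powR_mulrn// normrX.
by rewrite normr0 powR0.
Qed.

Lemma sobolev2_with_second_derivative f : continuous f ->
  exists2 phi, sobolev2 phi & forall x, 0 <= x <= 1 -> deriv01 (deriv01 phi) x = f x.
Proof.
move=> cf.
(* Integrating twice on nested intervals larger than [[0, 1]] makes every point of [[0, 1]]
   interior, so that ordinary two-sided derivatives are available at [0] and [1]. *)
have [F1 dF1] := @continuous_primitive (-2) 3 f (continuous_subspaceT cf).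
have cF1 : {within `[(-1)%R, 2], continuous F1}.
  apply: derivable_within_continuous => x; rewrite in_itv/= => /andP[x1 x2].
  have x23 : -2 < x < 3 by apply/andP; split; lra.
  by have [] := dF1 x x23.
have [F2 dF2] := continuous_primitive cF1.
have d2 x : 0 <= x <= 1 -> derivable01 F2 x /\ deriv01 F2 x = F1 x.
  move=> x01; apply: is_derive_deriv01 => //; apply: dF2.
  by case/andP: x01 => *; apply/andP; split; lra.
have E2 x : 0 <= x <= 1 -> deriv01 (deriv01 F2) x = f x.
  move=> x01; rewrite (@eq_deriv01 _ _ F1)//; last first.
    by move=> y; rewrite in_itv/= => /d2[].
  apply: (is_derive_deriv01 x01 _).2; apply: dF1.
  by case/andP: x01 => *; apply/andP; split; lra.
exists F2 => //; split.
- by move=> x /d2[].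
- apply: (@eq_abs_continuous _ _ _ F1); first by move=> x /d2[].
  have [M hM] := within_continuous_bounded (continuous_subspaceT cf : {within `[0, 1], continuous f}).
  apply: (@bounded_derive_abs_continuous _ _ _ _ f M).
  + by apply: continuous_subspaceW cF1; apply: subset_itv; rewrite bnd_simp; lra.
  + by move=> x /andP[? ?]; apply: dF1; apply/andP; split; lra.
  + by move=> x /andP[? ?]; apply: hM; apply/andP; split; lra.
- have -> : deriv01 (deriv01 F2) \_ `[0, 1] = f \_ `[0, 1].
    apply/funext => x; rewrite !patchE; case: ifPn => //; rewrite inE/= in_itv/=.
    exact: E2.
  exact: continuous_Lfun2.
Qed.

(* The step-periodic kernel as a sum of truncations, which makes continuity at the
   knots immediate. *)
Definition kerEMp N x : R := step N ^+ 2 / 12 -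
  (\sum_(k < N) Num.max 0 ((x - knot N k) * (knot N k.+1 - x))) / 2.

Lemma continuous_kerEMp N : continuous (kerEMp N).
Proof.
have cS n : continuous (fun x : R =>
    \sum_(k < n) Num.max 0 ((x - knot N k) * (knot N k.+1 - x))).
  elim: n => [|n ih].
    have -> : (fun x : R => \sum_(k < 0)
        Num.max 0 ((x - knot N k) * (knot N k.+1 - x))) = cst 0.
      by apply/funext => x; rewrite big_ord0.
    exact: cst_continuous.
  have -> : (fun x : R => \sum_(k < n.+1)
        Num.max 0 ((x - knot N k) * (knot N k.+1 - x))) =
      (fun x : R => \sum_(k < n) Num.max 0 ((x - knot N k) * (knot N k.+1 - x)) +
        Num.max 0 ((x - knot N n) * (knot N n.+1 - x))).
    by apply/funext => x; rewrite big_ord_recr.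
  move=> x; apply: cvgD; first exact: ih.
  have := @continuous_max R R (cst 0) (fun x => (x - knot N n) * (knot N n.+1 - x)) x.
  apply; first exact: cvg_cst.
  apply: cvgM; apply: cvgB; [exact: cvg_id|exact: cvg_cst|exact: cvg_cst|exact: cvg_id].
move=> x; apply: cvgB; first exact: cvg_cst.
by apply: cvgM; [exact: cS|exact: cvg_cst].
Qed.

(* On the k-th interval the products indexed by i <> k are nonpositive, hence truncated. *)
Lemma kerEMp_itv N k x : (k < N)%N -> knot N k <= x <= knot N k.+1 ->
  kerEMp N x = kerEM (knot N k) (knot N k.+1) x.
Proof.
move=> kN /andP[kx xk]; rewrite /kerEMp /kerEM knotS (bigD1 (Ordinal kN))//= big1.
  rewrite max_r; first by field.
  by rewrite mulr_ge0// subr_ge0.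
move=> i ik; have {}ik : (i : nat) != k by [].
rewrite max_l//; case: (ltngtP i k) ik => // ik _.
  have : knot N i.+1 <= knot N k :> R := @knot_mono R N _ _ ik.
  have : knot N i <= knot N k :> R := @knot_mono R N _ _ (ltnW ik).
  by move=> h1 h2; rewrite mulr_ge0_le0 ?subr_ge0 ?subr_le0; lra.
have : knot N k.+1 <= knot N i :> R := @knot_mono R N _ _ ik.
have : knot N k.+1 <= knot N i.+1 :> R := @knot_mono R N _ _ (leqW ik).
by move=> h1 h2; rewrite mulr_le0_ge0 ?subr_ge0 ?subr_le0; lra.
Qed.

(** Taking the second derivative equal to the kernel divided by its norm [S] gives equality in
    Cauchy-Schwarz: the semi-norm squared is [S2 / S ^ 2 = 1] and the functional takes the value
    [S2 / S = S]. *)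
Lemma ell_EM_extremal N : (0 < N)%N ->
  let S2 := \sum_(k < N) \int[mu]_(x in `[knot N k, knot N k.+1])
    (kerEM (knot N k) (knot N k.+1) x ^+ 2) in
  0 < S2 ->
  exists phi, [/\ sobolev2 phi, L22_norm phi = 1 & ell_EM N phi = Num.sqrt S2].
Proof.
move=> N0 S2 S20; pose S := Num.sqrt S2.
have S0 : 0 < S by rewrite sqrtr_gt0.
have SS : S ^+ 2 = S2 by rewrite sqr_sqrtr// ltW.
have cf : continuous (fun x => S^-1 * kerEMp N x).
  by move=> x; apply: cvgM; [exact: cvg_cst|exact: continuous_kerEMp].
have [phi sphi dphi] := sobolev2_with_second_derivative cf.
have k01 k : (k < N)%N -> forall x, x \in `[knot N k, knot N k.+1] -> 0 <= x <= 1.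
  move=> kN x; rewrite in_itv/= => /andP[kx xk]; apply/andP; split.
    by apply: le_trans kx; rewrite -(knot0 N); exact: (@knot_mono R N 0%N k).
  by apply: (le_trans xk); rewrite -(knotN N0); exact: (@knot_mono R N k.+1 N).
have E (k : 'I_N) x : x \in `[knot N k, knot N k.+1] ->
    deriv01 (deriv01 phi) x = S^-1 * kerEM (knot N k) (knot N k.+1) x.
  move=> xk; have x01 := k01 k (ltn_ord k) x xk.
  by rewrite (dphi x x01) (kerEMp_itv (ltn_ord k))//; move: xk; rewrite in_itv.
have iker2 (k : nat) a b : mu.-integrable `[a, b]
    (EFin \o (fun x => kerEM (knot N k) (knot N k.+1) x ^+ 2)).
  by apply: continuous_integrable; apply: continuous_sqr; exact: continuous_kerEM.
exists phi; split => //.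
- rewrite /L22_norm -[RHS]sqrtr1; congr Num.sqrt.
  have -> : \int[mu]_(x in `[0, 1]) (deriv01 (deriv01 phi) x ^+ 2) =
      \int[mu]_(x in `[0, 1]) ((S^-1 * kerEMp N x) ^+ 2).
    by apply: eq_Rintegral => x; rewrite inE/= in_itv/= => x01; rewrite dphi.
  have := @Rintegral_sum_itv _ (knot N) N (fun x => (S^-1 * kerEMp N x) ^+ 2) (@knot_mono R N).
  rewrite knot0 knotN// => ->; last by apply: continuous_integrable; exact: continuous_sqr.
  rewrite (eq_bigr (fun k : 'I_N => S^-1 ^+ 2 * \int[mu]_(x in `[knot N k, knot N k.+1])
    (kerEM (knot N k) (knot N k.+1) x ^+ 2))).
    by rewrite -mulr_sumr -/S2 -SS exprVn mulVf// expf_neq0// gt_eqF.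
  move=> k _; rewrite -RintegralZl//.
  apply: eq_Rintegral => x; rewrite inE/= => xk.
  by rewrite (kerEMp_itv (ltn_ord k)) ?exprMn//; move: xk; rewrite in_itv.
- rewrite ell_EM_kernel//.
  rewrite (eq_bigr (fun k : 'I_N => S^-1 * \int[mu]_(x in `[knot N k, knot N k.+1])
    (kerEM (knot N k) (knot N k.+1) x ^+ 2))).
    by rewrite -mulr_sumr -/S2 -SS expr2 mulKf// ?gt_eqF// -expr2 sqrtr_sqr gtr0_norm.
  move=> k _; rewrite -RintegralZl//.
  apply: eq_Rintegral => x; rewrite inE/= => xk.
  by rewrite (E k x xk); ring.
Qed.

End Extremal.

(** * Comparison of the two dual norms *)

Theorem mainTheorem4 (R : realType) (N : nat) (hN : (1 <= N)%N) :
  (dual_norm (@W21_norm R) (ell_opt N) < dual_norm (@L22_norm R) (ell_EM N))%E.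
Proof.
pose mu := @lebesgue_measure R.
pose T2 := \sum_(k < N) \int[mu]_(x in `[knot N k, knot N k.+1])
  (@kerOpt R (knot N k) (knot N k.+1) x ^+ 2).
pose S2 := \sum_(k < N) \int[mu]_(x in `[knot N k, knot N k.+1])
  (@kerEM R (knot N k) (knot N k.+1) x ^+ 2).
have TS : T2 < S2.
  apply: ltr_sum => [|k _]; first by apply/hasP; exists (Ordinal hN); rewrite ?mem_index_enum.
  exact/kerOpt_lt_kerEM/knot_lt.
have S20 : 0 < S2.
  apply: le_lt_trans TS; apply: sumr_ge0 => k _.
  by apply: Rintegral_ge0 => x _; exact: sqr_ge0.
have [phi [sphi n1 E]] := ell_EM_extremal hN S20.
pose S := Num.sqrt S2; have S0 : 0 < S by rewrite sqrtr_gt0.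
have SS : S ^+ 2 = S2 by rewrite sqr_sqrtr// ltW.
(* The number [S], the norm of the Euler-Maclaurin kernel, separates the two dual norms; the
   extremal function bounds the larger one from below. *)
apply: (@lt_le_trans _ _ S%:E); last first.
  apply: ereal_sup_ubound; exists phi; first by split.
  by rewrite E ger0_norm// ltW.
(* Young's inequality with this same [S] gives a bound smaller than [S] exactly when [T2 < S2], as
   multiplication by [2 * S] shows. Since this bound does not depend on the function, the strict
   inequality survives the supremum. *)
apply: (@le_lt_trans _ _ ((2 * S)^-1 * T2 + S / 2)%:E).
  apply: ge_ereal_sup => _ [f [sf nf] <-]; rewrite lee_fin.
  exact: ell_opt_le.
rewrite lte_fin -(@ltr_pM2l _ (2 * S)) ?mulr_gt0//.
have -> : 2 * S * ((2 * S)^-1 * T2 + S / 2) = T2 + S ^+ 2 by field; rewrite gt_eqF.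
by rewrite -mulrA -expr2 mulr_natl mulr2n SS ltrD2r.
Qed.
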